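(* Let $K$ be a complete nonarchimedean valued field with valuation $v$ such that $v(K^\times)=\mathbf R$, and let $V=\mathcal O_K=\{x\in K\mid v(x)\ge 0\}$ be its valuation ring. (i) In arbitrary characteristic, the following conditions are equivalent: (a) $K$ is spherically complete; (b) the formal power series ring $V[[T]]$ is coherent; (c) $V[[T]]$ is a GCD domain. (ii) If $K$ is perfect of characteristic $p$ (a prime), the following conditions are equivalent: (a) $K$ is spherically complete; (b) the ring $W(V)$ of $p$-typical Witt vectors of $V$ is coherent; (c) $W(V)$ is a GCD domain.
   Context: All rings are commutative with identity. A ring is coherent if every finitely generated ideal is finitely presented. A GCD domain is an integral domain in which every pair of nonzero elements has a greatest common divisor. Valuations are written additively. A valued field $(K,v)$ is spherically complete if every family of closed balls $\{x\in K\mid v(x-a)\ge r\}$ that is totally ordered by inclusion has nonempty intersection. *)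

(* Defs.v *)
From HB Require Import structures.
From mathcomp Require Import all_boot all_order all_algebra.
From mathcomp Require Import finmap monalg.
From mathcomp Require Import boolp classical_sets reals constructive_ereal.

Set Implicit Arguments.
Unset Strict Implicit.
Unset Printing Implicit Defensive.

Import Order.TTheory GRing.Theory Num.Theory.
Local Open Scope ring_scope.
Local Open Scope classical_set_scope.

Definition ideal_gen (R : comNzRingType) n (a : 'cV[R]_n) : set R :=
  range (fun c : 'rV[R]_n => (c *m a) 0 0).

Definition finitely_generated (R : comNzRingType) (I : set R) : Prop :=
  exists n (a : 'cV[R]_n), I = ideal_gen a.

(* An exact sequence R^m -> R^n -> I -> 0, the map R^n -> I being c |-> c *m a
   and the map R^m -> R^n being b |-> b *m S. *)
Definition finitely_presented (R : comNzRingType) (I : set R) : Prop :=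
  exists n (a : 'cV[R]_n), I = ideal_gen a /\
  exists m (S : 'M[R]_(m, n)),
    [set c : 'rV[R]_n | c *m a = 0] = range (fun b : 'rV[R]_m => b *m S).

Definition coherent (R : comNzRingType) : Prop :=
  forall I : set R, finitely_generated I -> finitely_presented I.

Definition divides (R : comNzRingType) (x y : R) : Prop :=
  exists z, y = z * x.

Definition is_gcd (R : comNzRingType) (x y d : R) : Prop :=
  [/\ divides d x, divides d y &
      forall e, divides e x -> divides e y -> divides e d].

Definition gcd_domain (R : comNzRingType) : Prop :=
  GRing.integral_domain_axiom R /\
  forall x y : R, x != 0 -> y != 0 -> exists d, is_gcd x y d.

Record valuation (R : realType) (K : fieldType) := Valuation {
  val_fun :> K -> \bar R;
  val_ninfty : forall x, val_fun x <> -oo%E;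
  val_eq_pinfty : forall x, val_fun x = +oo%E <-> x = 0;
  valM : forall x y, val_fun (x * y)%R = (val_fun x + val_fun y)%E;
  valD : forall x y, (mine (val_fun x) (val_fun y) <= val_fun (x + y)%R)%E
}.

Section Valuation.
Context (R : realType) (K : fieldType) (v : valuation R K).

Definition val_group_full : Prop :=
  [set v x | x in [set x : K | x != 0]] = range (@EFin R).

Definition val_cauchy (u : nat -> K) : Prop :=
  forall r : R, exists N, forall m n,
    (N <= m)%N -> (N <= n)%N -> (r%:E <= v (u m - u n)%R)%E.

Definition val_converges (u : nat -> K) (l : K) : Prop :=
  forall r : R, exists N, forall n, (N <= n)%N -> (r%:E <= v (u n - l)%R)%E.

Definition val_complete : Prop :=
  forall u, val_cauchy u -> exists l, val_converges u l.

Definition val_closed_ball (a : K) (r : R) : set K :=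
  [set x | (r%:E <= v (x - a)%R)%E].

Definition spherically_complete : Prop :=
  forall F : set (set K),
    (forall B, F B -> exists a r, B = val_closed_ball a r) ->
    (forall B C, F B -> F C -> B `<=` C \/ C `<=` B) ->
    (\bigcap_(B in F) B) !=set0.

Lemma val1 : v 1 = 0%E.
Proof.
have := valM v 1 1; rewrite mulr1.
have := @val_ninfty _ _ v 1.
have : v 1 <> +oo%E by move/val_eq_pinfty/eqP; rewrite oner_eq0.
case: (v 1) => [r| |] // _ _ [] /eqP.
by rewrite -subr_eq0 opprD addNKr oppr_eq0 => /eqP ->.
Qed.

Lemma valN1 : v (-1) = 0%E.
Proof.
have := valM v (-1) (-1); rewrite mulrNN mulr1 val1.
have := @val_ninfty _ _ v (-1).
have : v (-1) <> +oo%E by move/val_eq_pinfty/eqP; rewrite oppr_eq0 oner_eq0.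
case: (v (-1)) => [r| |] // _ _ [] /esym/eqP.
by rewrite -mulr2n mulrn_eq0 /= => /eqP ->.
Qed.

Definition val_ring_pred : {pred K} := fun x => (0 <= v x)%E.

Fact val_ring_subring : subring_closed val_ring_pred.
Proof.
split => [|x y|x y]; rewrite /in_mem /= /val_ring_pred.
- by rewrite val1.
- move=> x0 y0; apply: le_trans (valD v x (- y)).
  by rewrite le_min x0 -mulN1r valM valN1 add0e.
- by rewrite valM; exact: adde_ge0.
Qed.

HB.instance Definition _ :=
  GRing.isSubringClosed.Build K val_ring_pred val_ring_subring.

Record val_ring := ValRing {
  val_ring_val :> K;
  val_ringP : val_ring_val \in val_ring_pred
}.

HB.instance Definition _ := [isSub for val_ring_val].
HB.instance Definition _ := [Choice of val_ring by <:].
HB.instance Definition _ := [SubChoice_isSubComNzRing of val_ring by <:].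

End Valuation.

Record fps (A : Type) := Fps { fps_coef : nat -> A }.

HB.instance Definition _ (A : Type) := gen_eqMixin (fps A).
HB.instance Definition _ (A : Type) := gen_choiceMixin (fps A).

Section Fps.
Context (A : comNzRingType).
Implicit Types f g h : fps A.

Definition fps_zero : fps A := Fps (fun _ => 0).
Definition fps_one : fps A := Fps (fun n => (n == 0%N)%:R).
Definition fps_opp f := Fps (fun n => - fps_coef f n).
Definition fps_add f g := Fps (fun n => fps_coef f n + fps_coef g n).
Definition fps_mul f g :=
  Fps (fun n => \sum_(i < n.+1) fps_coef f i * fps_coef g (n - i)).

Lemma fpsP f g : fps_coef f =1 fps_coef g -> f = g.
Proof. by case: f g => f [g] /= /funext ->. Qed.

Let trunc N f : {poly A} := \poly_(i < N) fps_coef f i.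

Let fps_mul_trunc N f g n : (n < N)%N ->
  fps_coef (fps_mul f g) n = (trunc N f * trunc N g)`_n.
Proof.
move=> nN; rewrite coefM /=; apply: eq_bigr => i _.
by rewrite !coef_poly !ifT // (leq_ltn_trans _ nN) // ?leq_subr // -ltnS.
Qed.

Let trunc_coef N f n : (n < N)%N -> (trunc N f)`_n = fps_coef f n.
Proof. by move=> nN; rewrite coef_poly nN. Qed.

Fact fps_addA : associative fps_add.
Proof. by move=> f g h; apply: fpsP => n /=; rewrite addrA. Qed.
Fact fps_addC : commutative fps_add.
Proof. by move=> f g; apply: fpsP => n /=; rewrite addrC. Qed.
Fact fps_add0 : left_id fps_zero fps_add.
Proof. by move=> f; apply: fpsP => n /=; rewrite add0r. Qed.
Fact fps_addN : left_inverse fps_zero fps_opp fps_add.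
Proof. by move=> f; apply: fpsP => n /=; rewrite addNr. Qed.

HB.instance Definition _ :=
  GRing.isZmodule.Build (fps A) fps_addA fps_addC fps_add0 fps_addN.

Fact fps_mulC : commutative fps_mul.
Proof.
by move=> f g; apply: fpsP => n; rewrite !(@fps_mul_trunc n.+1) // mulrC.
Qed.

Fact fps_mulA : associative fps_mul.
Proof.
move=> f g h; apply: fpsP => n.
transitivity ((trunc n.+1 f * (trunc n.+1 g * trunc n.+1 h))`_n).
  rewrite coefM; apply: eq_bigr => i _.
  by rewrite trunc_coef // -(@fps_mul_trunc n.+1) // ltnS leq_subr.
rewrite mulrA coefM; apply: eq_bigr => i _.
by rewrite trunc_coef ?ltnS ?leq_subr // (@fps_mul_trunc n.+1).
Qed.

Fact fps_mul1 : left_id fps_one fps_mul.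
Proof.
move=> f; apply: fpsP => n /=; rewrite big_ord_recl /= mul1r subn0.
by rewrite big1 ?addr0 // => i _; rewrite mul0r.
Qed.

Fact fps_mulDl : left_distributive fps_mul fps_add.
Proof.
move=> f g h; apply: fpsP => n /=; rewrite -big_split /=.
by apply: eq_bigr => i _; rewrite mulrDl.
Qed.

Fact fps_one_neq0 : fps_one != 0.
Proof.
by apply/eqP => /(congr1 (fun f => fps_coef f 0)) /eqP; rewrite oner_eq0.
Qed.

HB.instance Definition _ := GRing.Zmodule_isComNzRing.Build (fps A)
  fps_mulA fps_mulC fps_mul1 fps_mulDl fps_one_neq0.

End Fps.

Section Zmalg.
Context (I : choiceType).
Local Notation zmalg := {malg int[{cmonom I}]}.

Fact malg_mulnI n (f g : zmalg) : (0 < n)%N -> f *+ n = g *+ n -> f = g.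
Proof.
move=> n0 fg; apply/malgP => m.
by apply: (pmulrnI n0); rewrite -!mcoeffMn fg.
Qed.

Definition malg_div (f : zmalg) (d : int) : zmalg :=
  [malg m in msupp f => (f@_m %/ d)%Z].

Fact malg_mulnK n (f : zmalg) : (0 < n)%N -> malg_div (f *+ n) n = f.
Proof.
move=> n0; apply/malgP => m; rewrite mcoeffE.
case: ifPn => [_|]; last first.
  rewrite -mcoeff_eq0 mcoeffMn mulrn_eq0 -[n == 0%N]negbK -lt0n n0 /=.
  by move=> /eqP ->.
by rewrite mcoeffMn -mulr_natr natz mulzK // eqz_nat -lt0n.
Qed.

Section Eval.
Context (A : comNzRingType) (e : I -> A).

Definition monom_eval (m : {cmonom I}) : A := \prod_(i <- finsupp m) e i ^+ m i.

Fact monom_evalE (d : {fset I}) (m : {cmonom I}) : (finsupp m `<=` d)%fset ->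
  monom_eval m = \prod_(i <- d) e i ^+ m i.
Proof.
move=> md; rewrite /monom_eval (big_fset_incl _ md) // => i _.
by rewrite -cmE_eq0 => /eqP ->.
Qed.

Fact monom_eval_mmorphism : mmorphism monom_eval.
Proof.
split=> [m n|]; last by rewrite /monom_eval mdom1 big_seq_fset0.
rewrite (@monom_evalE (finsupp m `|` finsupp n)%fset) ?mdomD //.
rewrite (@monom_evalE (finsupp m `|` finsupp n)%fset m) ?fsubsetUl //.
rewrite (@monom_evalE (finsupp m `|` finsupp n)%fset n) ?fsubsetUr //.
by rewrite -big_split /=; apply: eq_bigr => i _; rewrite cmM exprD.
Qed.

HB.instance Definition _ :=
  isMultiplicative.Build {cmonom I} A monom_eval monom_eval_mmorphism.

Definition malg_eval : zmalg -> A := mmap intr monom_eval.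
HB.instance Definition _ := GRing.RMorphism.on malg_eval.

Fact malg_eval_var i : malg_eval << ucm i >> = e i.
Proof.
by rewrite /malg_eval mmapU /monom_eval mdomU big_seq_fset1 cmUU mul1r expr1.
Qed.

End Eval.

Fact malg_ind (P : zmalg -> Prop) :
  P 1 -> (forall f g, P f -> P g -> P (f - g)) ->
  (forall f g, P f -> P g -> P (f * g)) -> (forall i, P << ucm i >>) ->
  forall f, P f.
Proof.
move=> P1 PB PM PX f.
have P0 : P 0 by rewrite -(subrr 1); exact: PB.
have PN g : P g -> P (- g) by rewrite -sub0r; exact: PB.
have PD g h : P g -> P h -> P (g + h).
  by move=> Pg Ph; rewrite -[h]opprK; apply: PB => //; exact: PN.
have PXn g n : P g -> P (g ^+ n).
  by move=> Pg; elim: n => [|n Pn]; rewrite ?expr0 // exprS; exact: PM.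
have Pmon (m : {cmonom I}) : P << m >>.
  have -> : << m >> = \prod_(i <- finsupp m) << ucm i >> ^+ m i :> zmalg.
    pose U k : {malg int[{cmonom I}]} := << k >>.
    have UM : {morph U : k l / mmul k l >-> k * l}.
      by move=> k l; rewrite /U malgM_def fgmulUU mulr1.
    have U1 : U mone = 1 by [].
    pose X i n : {cmonom I} := iter n (mmul (ucm i)) mone.
    have UX i n : << ucm i >> ^+ n = U (X i n).
      elim: n => [|n IHn]; first by rewrite expr0 U1.
      by rewrite exprS IHn /X iterS UM.
    under eq_bigr do rewrite UX.
    rewrite -(big_morph U UM U1); congr U; apply/eqP/cmP => j.
    have cmX i n : X i n j = ((i == j) * n)%N.
      elim: n => [|n IHn]; first by rewrite muln0 /X /= cm1.
      by rewrite /X iterS cmM cmU mulnS IHn.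
    rewrite (big_morph (fun k : {cmonom I} => k j)
      (fun k l => cmM j k l) (cm1 j)).
    under eq_bigr do rewrite cmX.
    case: (boolP (j \in finsupp m)) => jm.
      rewrite (big_fsetD1 j) //= eqxx mul1n big_seq big1 ?addn0 // => i.
      by rewrite in_fsetD1 => /andP[/negPf ->].
    rewrite big_seq big1 => [|i im]; first by apply/eqP; rewrite cmE_eq0.
    by case: eqP im jm => [-> ->|].
  by apply: (big_ind P P1 PM) => i _; exact: (PXn _ _ (PX i)).
rewrite [f]monalgE; apply: (big_ind P P0 PD) => m _.
have -> : << f@_m *g m >> = << m >> *~ (f@_m) :> zmalg.
  have -> : f@_m = 1 *~ f@_m by rewrite intz.
  rewrite -[LHS]/(mkmalgU m (1 *~ _)) raddfMz; congr (_ *~ _).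
  by rewrite intz.
have Pn n : P (<< m >> *+ n).
  by elim: n => [|n IHn]; rewrite ?mulr0n // mulrS; exact: (PD _ _ (Pmon m) IHn).
case: (f@_m) => n; first by rewrite -pmulrn; exact: Pn.
by rewrite NegzE mulrNz -pmulrn; exact: (PN _ (Pn _)).
Qed.

(* The ring Z[X_i | i in I]; zpoly_div f n divides every coefficient by n. *)
Definition zpoly : comNzRingType := zmalg.
Definition zvar (i : I) : zpoly := (<< ucm i >> : zmalg).
Definition zpoly_div (f : zpoly) (n : nat) : zpoly := malg_div f n.
Definition zeval (A : comNzRingType) (e : I -> A) : {rmorphism zpoly -> A} :=
  @malg_eval A e.

Lemma zpoly_mulnI n (f g : zpoly) : (0 < n)%N -> f *+ n = g *+ n -> f = g.
Proof. exact: malg_mulnI. Qed.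

Lemma zpoly_mulnK n (f : zpoly) : (0 < n)%N -> zpoly_div (f *+ n) n = f.
Proof. exact: malg_mulnK. Qed.

Lemma zeval_var (A : comNzRingType) (e : I -> A) i : zeval e (zvar i) = e i.
Proof. exact: malg_eval_var. Qed.

Lemma zpoly_ind (P : zpoly -> Prop) :
  P 1 -> (forall f g, P f -> P g -> P (f - g)) ->
  (forall f g, P f -> P g -> P (f * g)) -> (forall i, P (zvar i)) ->
  forall f, P f.
Proof. exact: malg_ind. Qed.

End Zmalg.

Lemma zeval_comp (I : choiceType) (A B : comNzRingType) (h : {rmorphism A -> B})
    (e : I -> A) f : h (zeval e f) = zeval (h \o e) f.
Proof.
elim/zpoly_ind: f => [|f g IHf IHg|f g IHf IHg|i].
- by rewrite !rmorph1.
- by rewrite !rmorphB IHf IHg.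
- by rewrite !rmorphM IHf IHg.
- by rewrite !zeval_var.
Qed.

Section Congruence.
Context (A : comNzRingType).
Implicit Types x y z : A.

Definition cong (d : nat) x y := exists z, x - y = z *+ d.

Lemma cong_refl d x : cong d x x.
Proof. by exists 0; rewrite subrr mul0rn. Qed.

Lemma cong_trans d y x z : cong d x y -> cong d y z -> cong d x z.
Proof.
move=> [u xy] [t yz]; exists (u + t).
by rewrite mulrnDl -xy -yz addrA subrK.
Qed.

Lemma congD d x y x' y' : cong d x y -> cong d x' y' -> cong d (x + x') (y + y').
Proof.
by move=> [u xy] [t xy']; exists (u + t); rewrite mulrnDl -xy -xy' addrACA opprD.
Qed.

Lemma congN d x y : cong d x y -> cong d (- x) (- y).
Proof. by move=> [u xy]; exists (- u); rewrite mulNrn -xy opprD. Qed.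

Lemma cong_sym d x y : cong d x y -> cong d y x.
Proof. by move=> [u xy]; exists (- u); rewrite mulNrn -xy opprB. Qed.

Lemma congM d x y x' y' : cong d x y -> cong d x' y' -> cong d (x * x') (y * y').
Proof.
move=> [u xy] [t xy']; exists (u * x' + y * t).
by rewrite mulrnDl -mulrnAl -xy -mulrnAr -xy' mulrBl mulrBr addrA subrK.
Qed.

Lemma congX d x y n : cong d x y -> cong d (x ^+ n) (y ^+ n).
Proof.
move=> xy; elim: n => [|n IHn]; first by rewrite !expr0; exact: cong_refl.
by rewrite !exprS; exact: congM.
Qed.

Lemma cong_sum d (J : Type) (r : seq J) (F G : J -> A) :
  (forall j, cong d (F j) (G j)) ->
  cong d (\sum_(j <- r) F j) (\sum_(j <- r) G j).
Proof.
move=> FG; elim: r => [|j r IHr]; first by rewrite !big_nil; exact: cong_refl.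
by rewrite !big_cons; exact: congD.
Qed.

Lemma congMn d n x y : cong d x y -> cong (d * n) (x *+ n) (y *+ n).
Proof. by move=> [u xy]; exists u; rewrite -mulrnBl xy mulrnA. Qed.

Lemma cong0 d x : cong d (x *+ d) 0.
Proof. by exists x; rewrite subr0. Qed.

Context (p : nat).

Lemma congXp k x y : cong (p ^ k.+1) x y -> cong (p ^ k.+2) (x ^+ p) (y ^+ p).
Proof.
move=> xy; move: (xy) => [u xyu].
have [t st] : cong p (\sum_(i < p) x ^+ (p.-1 - i) * y ^+ i) 0.
  apply: (@cong_trans _ (\sum_(i < p) y ^+ p.-1)).
    apply: cong_sum => i; have [ip|] := leqP i p.-1; last first.
      by case: p i => [|q] [i iq] //=; rewrite ltnNge -ltnS iq.
    rewrite -[X in cong _ _ (y ^+ X)](subnK ip) exprD.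
    apply: congM; last exact: cong_refl.
    apply: congX; move: xyu; rewrite expnS mulnC mulrnA => xyu.
    by exists (u *+ p ^ k).
  by rewrite sumr_const card_ord; exact: cong0.
exists (u * t); rewrite subrXX xyu -[X in _ * X]subr0 st.
by rewrite mulrnAl mulrnAr -mulrnA -expnS.
Qed.

Lemma congXpn k n x y : cong (p ^ k.+1) x y ->
  cong (p ^ (k.+1 + n)) (x ^+ (p ^ n)) (y ^+ (p ^ n)).
Proof.
move=> xy; elim: n => [|n IHn]; first by rewrite addn0 !expr1.
by rewrite (expnSr p n) !exprM addnS addSn; apply: congXp; rewrite -addSn.
Qed.

Lemma congXpD x y : prime p -> cong p ((x + y) ^+ p) (x ^+ p + y ^+ p).
Proof.
case: p => [|q] // q_pr; rewrite exprDn big_ord_recr big_ord_recl /=.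
rewrite subn0 subnn !expr0 !mulr1 !mul1r bin0 binn !mulr1n.
apply: congD; last exact: cong_refl.
rewrite -[X in cong _ _ X]addr0; apply: congD; first exact: cong_refl.
rewrite [X in cong _ _ X](_ : 0 = \sum_(i < q) (0 : A)); last by rewrite big1.
apply: cong_sum => i; rewrite /bump add1n.
have /dvdnP[c ->] : (q.+1 %| 'C(q.+1, i.+1))%N.
  by apply: prime_dvd_bin => //=; rewrite ltnS ltn_ord.
by rewrite mulrnA; exact: cong0.
Qed.

Lemma congXpN x : prime p -> cong p ((- x) ^+ p) (- x ^+ p).
Proof.
move=> p_pr; have [/eqP p2|p2] := boolP (p == 2)%N.
  by exists (x ^+ p); rewrite opprK p2 sqrrN mulr2n.
have [pE|p_odd] := even_prime p_pr; first by rewrite pE in p2.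
by rewrite exprNn -signr_odd p_odd expr1 mulN1r; exact: cong_refl.
Qed.

End Congruence.

Section Witt.
Context (p : nat).

(* The nth ghost component a_0^(p^n) + p a_1^(p^(n-1)) + ... + p^n a_n. *)
Definition ghost (A : comNzRingType) (a : nat -> A) (n : nat) : A :=
  \sum_(i < n.+1) a i ^+ (p ^ (n - i)) *+ p ^ i.

Lemma rmorph_ghost (A B : comNzRingType) (h : {rmorphism A -> B}) a n :
  h (ghost a n) = ghost (h \o a) n.
Proof.
rewrite rmorph_sum; apply: eq_bigr => i _.
by rewrite rmorphMn rmorphXn.
Qed.

Section GhostInv.
Context (A : comNzRingType) (quo : A -> nat -> A).

(* The solution S of the equations ghost S n = T n, obtained by solving
   successively for S_0, S_1, ...; here quo x n stands for x / n and is only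
   meaningful if the division is exact. *)
Fixpoint ghost_inv_seq (T : nat -> A) (n : nat) : seq A :=
  if n is m.+1 then
    let S := ghost_inv_seq T m in
    rcons S (quo (T m - \sum_(i < m) S`_i ^+ (p ^ (m - i)) *+ p ^ i) (p ^ m))
  else [::].

Definition ghost_inv (T : nat -> A) (n : nat) : A := (ghost_inv_seq T n.+1)`_n.

Lemma size_ghost_inv_seq T n : size (ghost_inv_seq T n) = n.
Proof. by elim: n => //= n IHn; rewrite size_rcons IHn. Qed.

Lemma nth_ghost_inv_seq T n i : (i < n)%N ->
  (ghost_inv_seq T n)`_i = ghost_inv T i.
Proof.
elim: n => // n IHn; rewrite ltnS leq_eqVlt => /orP[/eqP -> //|ni].
by rewrite /= nth_rcons size_ghost_inv_seq ni IHn.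
Qed.

Lemma ghost_invE T n : ghost_inv T n = quo
  (T n - \sum_(i < n) ghost_inv T i ^+ (p ^ (n - i)) *+ p ^ i) (p ^ n).
Proof.
rewrite {1}/ghost_inv /= nth_rcons size_ghost_inv_seq ltnn eqxx.
congr (quo (_ - _) _); apply: eq_bigr => i _.
by rewrite nth_ghost_inv_seq.
Qed.

Hypothesis p_pr : prime p.
Let p_gt0 n : (0 < p ^ n)%N. Proof. by rewrite expn_gt0 prime_gt0. Qed.

Lemma ghost_inj (a b : nat -> A) :
  (forall n (x y : A), (0 < n)%N -> x *+ n = y *+ n -> x = y) ->
  ghost a =1 ghost b -> a = b.
Proof.
move=> mulnI ab; apply/funext => n; elim/ltn_ind: n => n IHn.
have := ab n; rewrite /ghost !big_ord_recr /= subnn !expr1.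
under eq_bigr => i _ do rewrite IHn //.
by move=> /addrI; exact: mulnI.
Qed.

(* Dwork's criterion, for a lift of Frobenius frob. *)
Hypothesis quoK : forall n x, (0 < n)%N -> quo (x *+ n) n = x.
Context (frob : {rmorphism A -> A}).
Hypothesis frobP : forall x, cong p (frob x) (x ^+ p).

Definition dwork (T : nat -> A) :=
  forall n, cong (p ^ n.+1) (T n.+1) (frob (T n)).

Lemma ghost_invK T : dwork T -> ghost (ghost_inv T) =1 T.
Proof.
move=> dT; elim=> [|n IHn].
  rewrite /ghost big_ord1 ghost_invE big_ord0 subr0 /= expr1 expn0.
  by rewrite -[X in quo X]mulr1n quoK.
have [u uE] : cong (p ^ n.+1) (T n.+1)
    (\sum_(i < n.+1) ghost_inv T i ^+ (p ^ (n.+1 - i)) *+ p ^ i).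
  apply: cong_trans (dT n) _; rewrite -IHn rmorph_ghost.
  apply: cong_sum => i; have iLn : (i <= n)%N by rewrite -ltnS.
  rewrite (subSn iLn) (expnS p (n - i)) exprM.
  have -> : (p ^ n.+1 = p ^ (1 + (n - i)) * p ^ i)%N.
    by rewrite -expnD -addnA subnK.
  apply: congMn; apply: congXpn.
  by rewrite expn1; exact: frobP.
rewrite /ghost big_ord_recr /= subnn expr1 [X in _ + X *+ _]ghost_invE uE.
by rewrite quoK // -uE addrC subrK.
Qed.

Lemma dworkX (x : nat -> A) : (forall i, frob (x i) = x i ^+ p) ->
  dwork (ghost x).
Proof.
move=> frobx n; rewrite rmorph_ghost /ghost big_ord_recr /=.
rewrite -[X in cong _ _ X]addr0; apply: congD; last exact: cong0.
rewrite [X in cong _ _ X](_ : _ =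
  \sum_(i < n.+1) x i ^+ (p ^ (n.+1 - i)) *+ p ^ i); first exact: cong_refl.
by apply: eq_bigr => i _; rewrite /= frobx -exprM -expnS subSn // -ltnS.
Qed.

Lemma dworkD T U : dwork T -> dwork U -> dwork (fun n => T n + U n).
Proof. by move=> dT dU n; rewrite rmorphD; exact: congD. Qed.

Lemma dworkM T U : dwork T -> dwork U -> dwork (fun n => T n * U n).
Proof. by move=> dT dU n; rewrite rmorphM; exact: congM. Qed.

Lemma dworkN T : dwork T -> dwork (fun n => - T n).
Proof. by move=> dT n; rewrite rmorphN; exact: congN. Qed.

End GhostInv.

Lemma cong_frobB (A : comNzRingType) (h : {rmorphism A -> A}) x y : prime p ->
  cong p (h x) (x ^+ p) -> cong p (h y) (y ^+ p) ->
  cong p (h (x - y)) ((x - y) ^+ p).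
Proof.
move=> p_pr hx hy; rewrite rmorphB.
apply: cong_trans (cong_sym (congXpD _ _ p_pr)); apply: congD => //.
by apply: cong_trans (cong_sym (congXpN _ p_pr)); exact: congN.
Qed.

Lemma cong_frobM (A : comNzRingType) (h : {rmorphism A -> A}) x y :
  cong p (h x) (x ^+ p) -> cong p (h y) (y ^+ p) ->
  cong p (h (x * y)) ((x * y) ^+ p).
Proof. by move=> hx hy; rewrite rmorphM exprMn; exact: congM. Qed.

Lemma cong_frob1 (A : comNzRingType) (h : {rmorphism A -> A}) :
  cong p (h 1) (1 ^+ p).
Proof. by rewrite rmorph1 expr1n; exact: cong_refl. Qed.

Definition zfrob (I : choiceType) : {rmorphism zpoly I -> zpoly I} :=
  zeval (fun i => zvar i ^+ p).

Lemma zfrob_var (I : choiceType) (i : I) : zfrob I (zvar i) = zvar i ^+ p.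
Proof. exact: zeval_var. Qed.

Lemma zfrobP (I : choiceType) : prime p ->
  forall f, cong p (zfrob I f) (f ^+ p).
Proof.
move=> p_pr; apply: zpoly_ind => [|f g|f g|i].
- exact: cong_frob1.
- exact: cong_frobB.
- exact: cong_frobM.
- by rewrite zfrob_var; exact: cong_refl.
Qed.

End Witt.

(* The universal polynomials of Witt vector addition, multiplication and
   opposite; the indeterminates X_i and Y_i have indices (false, i) and
   (true, i). *)
Definition wittX (i : nat) : zpoly (bool * nat)%type := zvar (false, i).
Definition wittY (i : nat) : zpoly (bool * nat)%type := zvar (true, i).

HB.lock Definition witt_add_poly (p : nat) : nat -> zpoly (bool * nat)%type :=
  ghost_inv p (@zpoly_div _) (fun n => ghost p wittX n + ghost p wittY n).
HB.lock Definition witt_mul_poly (p : nat) : nat -> zpoly (bool * nat)%type :=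
  ghost_inv p (@zpoly_div _) (fun n => ghost p wittX n * ghost p wittY n).
HB.lock Definition witt_opp_poly (p : nat) : nat -> zpoly (bool * nat)%type :=
  ghost_inv p (@zpoly_div _) (fun n => - ghost p wittX n).

Lemma ghost_witt_add_poly p n : prime p ->
  ghost p (witt_add_poly p) n = ghost p wittX n + ghost p wittY n.
Proof.
move=> p_pr; rewrite unlock.
apply: (ghost_invK p_pr (@zpoly_mulnK _) (zfrobP p_pr)).
by apply: dworkD; apply: dworkX => i; exact: zfrob_var.
Qed.

Lemma ghost_witt_mul_poly p n : prime p ->
  ghost p (witt_mul_poly p) n = ghost p wittX n * ghost p wittY n.
Proof.
move=> p_pr; rewrite unlock.
apply: (ghost_invK p_pr (@zpoly_mulnK _) (zfrobP p_pr)).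
by apply: dworkM; apply: dworkX => i; exact: zfrob_var.
Qed.

Lemma ghost_witt_opp_poly p n : prime p ->
  ghost p (witt_opp_poly p) n = - ghost p wittX n.
Proof.
move=> p_pr; rewrite unlock.
apply: (ghost_invK p_pr (@zpoly_mulnK _) (zfrobP p_pr)).
by apply: dworkN; apply: dworkX => i; exact: zfrob_var.
Qed.

Definition witt_eval (A : comNzRingType) (a b : nat -> A) :
    {rmorphism zpoly (bool * nat)%type -> A} :=
  zeval (fun k => if k.1 then b k.2 else a k.2).

(* Witt vectors are sequences; primality of p is recorded in the type since it
   is needed for the Witt polynomials to be integral. *)
Record witt (p : nat) (p_pr : prime p) (A : Type) :=
  Witt { witt_coef : nat -> A }.
Arguments Witt {p} p_pr {A}.

HB.instance Definition _ p (p_pr : prime p) (A : Type) :=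
  gen_eqMixin (witt p_pr A).
HB.instance Definition _ p (p_pr : prime p) (A : Type) :=
  gen_choiceMixin (witt p_pr A).

Section WittRing.
Context (p : nat) (p_pr : prime p).

Section Def.
Context (A : comNzRingType).
Implicit Types a b : witt p_pr A.

Definition witt_zero : witt p_pr A := Witt p_pr (fun _ => 0).
Definition witt_one : witt p_pr A := Witt p_pr (fun n => (n == 0%N)%:R).
Definition witt_add a b := Witt p_pr (fun n =>
  witt_eval (witt_coef a) (witt_coef b) (witt_add_poly p n)).
Definition witt_mul a b := Witt p_pr (fun n =>
  witt_eval (witt_coef a) (witt_coef b) (witt_mul_poly p n)).
Definition witt_opp a := Witt p_pr (fun n =>
  witt_eval (witt_coef a) (witt_coef a) (witt_opp_poly p n)).

Definition witt_ghost a : nat -> A := ghost p (witt_coef a).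

Lemma witt_ghost0 n : witt_ghost witt_zero n = 0.
Proof.
rewrite /witt_ghost /ghost big1 // => i _.
by rewrite expr0n -[_ == _]negbK -lt0n expn_gt0 prime_gt0 //= mul0rn.
Qed.

Lemma witt_ghost1 n : witt_ghost witt_one n = 1.
Proof.
rewrite /witt_ghost /ghost big_ord_recl /= expr1n big1 ?addr0 // => i _.
by rewrite expr0n -[_ == _]negbK -lt0n expn_gt0 prime_gt0 //= mul0rn.
Qed.

Lemma ghost_wittX a b n :
  witt_eval (witt_coef a) (witt_coef b) (ghost p wittX n) = witt_ghost a n.
Proof.
rewrite rmorph_ghost; apply: eq_bigr => i _.
by rewrite /witt_eval /= zeval_var.
Qed.

Lemma ghost_wittY a b n :
  witt_eval (witt_coef a) (witt_coef b) (ghost p wittY n) = witt_ghost b n.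
Proof.
rewrite rmorph_ghost; apply: eq_bigr => i _.
by rewrite /witt_eval /= zeval_var.
Qed.

Lemma witt_ghostD a b n :
  witt_ghost (witt_add a b) n = witt_ghost a n + witt_ghost b n.
Proof.
rewrite -(ghost_wittX a b) -(ghost_wittY a b) -rmorphD.
by rewrite -ghost_witt_add_poly // rmorph_ghost.
Qed.

Lemma witt_ghostM a b n :
  witt_ghost (witt_mul a b) n = witt_ghost a n * witt_ghost b n.
Proof.
rewrite -(ghost_wittX a b) -(ghost_wittY a b) -rmorphM.
by rewrite -ghost_witt_mul_poly // rmorph_ghost.
Qed.

Lemma witt_ghostN a n : witt_ghost (witt_opp a) n = - witt_ghost a n.
Proof.
rewrite -(ghost_wittX a a) -rmorphN.
by rewrite -ghost_witt_opp_poly // rmorph_ghost.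
Qed.

End Def.

Section Functoriality.
Context (A B : comNzRingType) (h : {rmorphism A -> B}).

Definition witt_map (a : witt p_pr A) : witt p_pr B :=
  Witt p_pr (h \o witt_coef a).

Let witt_map_eval (a b : nat -> A) f :
  h (witt_eval a b f) = witt_eval (h \o a) (h \o b) f.
Proof.
rewrite /witt_eval zeval_comp; congr (zeval _ f).
by apply/funext => -[[] i].
Qed.

Lemma witt_map0 : witt_map (witt_zero A) = witt_zero B.
Proof. by congr Witt; apply/funext => n /=; rewrite rmorph0. Qed.

Lemma witt_map1 : witt_map (witt_one A) = witt_one B.
Proof. by congr Witt; apply/funext => n /=; rewrite rmorph_nat. Qed.

Lemma witt_mapD a b :
  witt_map (witt_add a b) = witt_add (witt_map a) (witt_map b).
Proof. by congr Witt; apply/funext => n /=; rewrite witt_map_eval. Qed.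

Lemma witt_mapM a b :
  witt_map (witt_mul a b) = witt_mul (witt_map a) (witt_map b).
Proof. by congr Witt; apply/funext => n /=; rewrite witt_map_eval. Qed.

Lemma witt_mapN a : witt_map (witt_opp a) = witt_opp (witt_map a).
Proof. by congr Witt; apply/funext => n /=; rewrite witt_map_eval. Qed.

End Functoriality.

(* The ring axioms hold over a torsion-free ring and descend to quotients. *)
Section Descent.
Context (A B : comNzRingType) (h : {rmorphism B -> A}).
Hypothesis mulnI : forall n (x y : B), (0 < n)%N -> x *+ n = y *+ n -> x = y.
Hypothesis h_surj : forall x, exists y, x = h y.

Let projP (a : witt p_pr A) : exists b, a = witt_map h b.
Proof.
case: a => a; have [b ab] := choice (fun n => h_surj (a n)).
by exists (Witt p_pr b); congr Witt; apply/funext.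
Qed.

Let witt_ghost_inj (a b : witt p_pr B) : witt_ghost a =1 witt_ghost b -> a = b.
Proof. by case: a b => a [b] /(ghost_inj p_pr mulnI) /= ->. Qed.

Fact descend_addA : associative (@witt_add A).
Proof.
move=> a b c; case: (projP a) (projP b) (projP c) => [x ->] [y ->] [z ->].
rewrite -!witt_mapD.
apply: (congr1 (witt_map _)); apply: witt_ghost_inj => n.
by rewrite !witt_ghostD addrA.
Qed.

Fact descend_addC : commutative (@witt_add A).
Proof.
move=> a b; case: (projP a) (projP b) => [x ->] [y ->].
rewrite -!witt_mapD.
apply: (congr1 (witt_map _)); apply: witt_ghost_inj => n.
by rewrite !witt_ghostD addrC.
Qed.

Fact descend_add0 : left_id (@witt_zero A) (@witt_add A).
Proof.
move=> a; case: (projP a) => [x ->].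
rewrite -(witt_map0 h) -witt_mapD.
apply: (congr1 (witt_map _)); apply: witt_ghost_inj => n.
by rewrite witt_ghostD witt_ghost0 add0r.
Qed.

Fact descend_addN : left_inverse (@witt_zero A) (@witt_opp A) (@witt_add A).
Proof.
move=> a; case: (projP a) => [x ->].
rewrite -(witt_map0 h) -witt_mapN -witt_mapD.
apply: (congr1 (witt_map _)); apply: witt_ghost_inj => n.
by rewrite witt_ghostD witt_ghostN witt_ghost0 addNr.
Qed.

Fact descend_mulA : associative (@witt_mul A).
Proof.
move=> a b c; case: (projP a) (projP b) (projP c) => [x ->] [y ->] [z ->].
rewrite -!witt_mapM.
apply: (congr1 (witt_map _)); apply: witt_ghost_inj => n.
by rewrite !witt_ghostM mulrA.
Qed.

Fact descend_mulC : commutative (@witt_mul A).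
Proof.
move=> a b; case: (projP a) (projP b) => [x ->] [y ->].
rewrite -!witt_mapM.
apply: (congr1 (witt_map _)); apply: witt_ghost_inj => n.
by rewrite !witt_ghostM mulrC.
Qed.

Fact descend_mul1 : left_id (@witt_one A) (@witt_mul A).
Proof.
move=> a; case: (projP a) => [x ->].
rewrite -(witt_map1 h) -witt_mapM.
apply: (congr1 (witt_map _)); apply: witt_ghost_inj => n.
by rewrite witt_ghostM witt_ghost1 mul1r.
Qed.

Fact descend_mulDl : left_distributive (@witt_mul A) (@witt_add A).
Proof.
move=> a b c; case: (projP a) (projP b) (projP c) => [x ->] [y ->] [z ->].
rewrite -witt_mapD -!witt_mapM -witt_mapD.
apply: (congr1 (witt_map _)); apply: witt_ghost_inj => n.
by rewrite witt_ghostD !witt_ghostM witt_ghostD mulrDl.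
Qed.

End Descent.

Section WittComRing.
Context (A : comNzRingType).

Let zeval_surj (x : A) : exists f : zpoly A, x = zeval id f.
Proof. by exists (zvar x); rewrite zeval_var. Qed.

Fact witt_addA : associative (@witt_add A).
Proof. exact: descend_addA (@zpoly_mulnI A) zeval_surj. Qed.

Fact witt_addC : commutative (@witt_add A).
Proof. exact: descend_addC (@zpoly_mulnI A) zeval_surj. Qed.

Fact witt_add0 : left_id (@witt_zero A) (@witt_add A).
Proof. exact: descend_add0 (@zpoly_mulnI A) zeval_surj. Qed.

Fact witt_addN : left_inverse (@witt_zero A) (@witt_opp A) (@witt_add A).
Proof. exact: descend_addN (@zpoly_mulnI A) zeval_surj. Qed.

HB.instance Definition _ := GRing.isZmodule.Build (witt p_pr A)
  witt_addA witt_addC witt_add0 witt_addN.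

Fact witt_mulA : associative (@witt_mul A).
Proof. exact: descend_mulA (@zpoly_mulnI A) zeval_surj. Qed.

Fact witt_mulC : commutative (@witt_mul A).
Proof. exact: descend_mulC (@zpoly_mulnI A) zeval_surj. Qed.

Fact witt_mul1 : left_id (@witt_one A) (@witt_mul A).
Proof. exact: descend_mul1 (@zpoly_mulnI A) zeval_surj. Qed.

Fact witt_mulDl : left_distributive (@witt_mul A) (@witt_add A).
Proof. exact: descend_mulDl (@zpoly_mulnI A) zeval_surj. Qed.

Fact witt_one_neq0 : @witt_one A != @witt_zero A.
Proof.
apply/eqP => /(congr1 (fun a => witt_coef a 0)) /eqP.
by rewrite oner_eq0.
Qed.

HB.instance Definition _ := GRing.Zmodule_isComNzRing.Build (witt p_pr A)
  witt_mulA witt_mulC witt_mul1 witt_mulDl witt_one_neq0.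

End WittComRing.
End WittRing.

(* Main.v *)
(* Both V[[T]] and, for perfect V, W(V) with T = p are T-adically complete and
   separated, T is regular with residue ring V, and the residue map has a
   multiplicative section; nothing else about these rings is used.

   Let N be the module of relations between finitely many elements and M in V^n
   its reduction modulo T. If K is spherically complete, a system
   w_k = d_k w_(k+1) - z_k with d_0 d_1 d_2 ... of finite valuation can be solved
   in every submodule of V^n: for an ideal of V the solution is a point in an
   intersection of balls. Solving modulo T, T^2, ... gives solutions in N, from
   which M contains every x such that c x lies in M for all c of positive
   valuation. Such an M is finitely generated, and so is N by completeness.
   Coherence implies the GCD property since the relations between two elements
   then reduce to a cyclic module, hence are themselves cyclic.

   Conversely, an empty intersection of balls yields t_k in V whose valuations
   2^-(k+1) are summable such that the balls around the sums of the 1/t_j, j < k,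
   have no common point. The elements [t_k]^n - (-T)^n are divisible by
   [t_k] + T, and suitably normalised infinite products of them with n = k + 1
   and n = k + 2 converge T-adically. These two products have no essential common
   divisor besides the [t_k] + T, so their gcd h has a zero exactly at each
   -[t_k], and the logarithmic derivative of h at T = 0, that is the quotient of
   its first two digits, is a common point of the balls. *)
Require Import Defs.
From HB Require Import structures.
From mathcomp Require Import all_boot all_order all_algebra.
From mathcomp Require Import boolp classical_sets reals constructive_ereal.
From mathcomp Require Import ring lra zify.

Set Implicit Arguments.
Unset Strict Implicit.
Unset Printing Implicit Defensive.

Import Order.TTheory GRing.Theory Num.Theory.
Local Open Scope ring_scope.
Local Open Scope classical_set_scope.

(** * Strict lifts *)

(** Separatedness and completeness are phrased without limits: in [unif_sep], [E i] is a quotient of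
    [E 0] by [unif ^ i], and in [unif_compl], [X i] plays the tail sum of the
    [teich (a (i + j)) * unif ^ j]. *)
Record strict_lift (V A : comNzRingType) := StrictLift {
  unif : A;
  res : {rmorphism A -> V};
  teich : V -> A;
  teich1 : teich 1 = 1;
  teichM : {morph teich : a b / a * b};
  res_teich : cancel teich res;
  res_unif : res unif = 0;
  res_eq0 : forall x, res x = 0 -> exists y, x = unif * y;
  unifI : forall x, unif * x = 0 -> x = 0;
  unif_sep : forall E : nat -> A, (forall i, E i = unif * E i.+1) -> E 0%N = 0;
  unif_compl : forall a : nat -> V,
    exists X : nat -> A, forall i, X i = teich (a i) + unif * X i.+1
}.

Section StrictLift.
Context (V A : comNzRingType) (L : strict_lift V A).
Local Notation T := (unif L).
Local Notation res := (res L).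
Local Notation tau := (teich L).

Lemma unif_mulI : injective (fun x => T * x).
Proof.
move=> x y /eqP; rewrite -subr_eq0 -mulrBr => /eqP /unifI /eqP.
by rewrite subr_eq0 => /eqP.
Qed.

Lemma teichX a n : tau (a ^+ n) = tau a ^+ n.
Proof.
by elim: n => [|n IHn]; rewrite ?expr0 ?teich1 // !exprS teichM IHn.
Qed.

Lemma res_eq x y : res x = res y -> exists z, x = y + T * z.
Proof.
move=> xy; have [|z zE] := @res_eq0 _ _ L (x - y); first by rewrite rmorphB xy subrr.
by exists z; rewrite -zE addrC subrK.
Qed.

(** The terms are now arbitrary elements of [A]; carrying turns them into digits, to which
    [unif_compl] applies. *)
Lemma unif_series (y : nat -> A) :
  exists Y : nat -> A, forall i, Y i = y i + T * Y i.+1.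
Proof.
have /choice[r rE] x : exists r, x = tau (res x) + T * r.
  by apply: res_eq; rewrite res_teich.
(* [s m] is [y m] plus the carry from position [m - 1], and its residue is the digit at [m]. The
   tail [X m] includes that carry [s m - y m], which the witness removes. *)
pose s := fix s m := if m is n.+1 then r (s n) + y n.+1 else y 0%N.
have [X XE] := unif_compl L (fun m => res (s m)).
exists (fun m => X m - (s m - y m)) => m.
rewrite XE [X in X - y m]rE /=; ring.
Qed.

(** Since [T] is regular, quotients by its powers are unique, so those of [x] satisfy the recursion
    that [unif_sep] asks for. *)
Lemma unifX_sep x : (forall n, exists y, x = T ^+ n * y) -> x = 0.
Proof.
move=> /choice[E xE]; have -> : x = E 0%N by rewrite (xE 0) mul1r.
apply: (unif_sep (s:=L)) => i.
have TnI n u w : T ^+ n * u = T ^+ n * w -> u = w.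
  elim: n => [|n IHn]; first by rewrite !mul1r.
  by rewrite exprS -!mulrA => /unif_mulI.
by apply: (TnI i); rewrite -xE mulrA -exprSr -xE.
Qed.

Lemma unif_factor x : x != 0 -> exists n y, x = T ^+ n * y /\ res y != 0.
Proof.
apply: contra_neqP => nx; apply: unifX_sep; elim=> [|n [y yE]].
  by exists x; rewrite mul1r.
have /res_eq0[z zE] : res y = 0.
  by apply/eqP; apply: contra_notT nx => y0; exists n, y.
by exists z; rewrite exprSr -mulrA -zE.
Qed.

(* Multiplicativity of teich makes the second digit additive in products. *)
Lemma res_factorM x y x' y' :
  (tau x + T * x') * (tau y + T * y') =
  tau (x * y) + T * (tau x * y' + tau y * x' + T * (x' * y')).
Proof. rewrite teichM; ring. Qed.

Hypothesis V_domain : GRing.integral_domain_axiom V.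

(** Modulo [T] the relation forces [res y = 0], and regularity of [T] passes it on to [y / T]. Hence
    [y] can be divided by [T] forever. *)
Lemma lift_mulI x y : res x != 0 -> x * y = 0 -> y = 0.
Proof.
move=> x0; have step z : exists z', x * z = 0 -> z = T * z' /\ x * z' = 0.
  case: (pselect (x * z = 0)) => [xz|]; last by exists 0.
  have /res_eq0[z' zE] : res z = 0.
    move/(congr1 res): xz; rewrite rmorphM rmorph0 => /V_domain.
    by rewrite (negPf x0) => /eqP.
  exists z' => _; split=> //; apply: (unifI (s:=L)).
  by rewrite mulrCA -zE.
have [s sP] := choice step; move=> xy.
pose E := fix E n := if n is m.+1 then s (E m) else y.
have xE n : x * E n = 0 by elim: n => //= n /sP[].
by apply: (unif_sep (s:=L) (E:=E)) => n; case: (sP _ (xE n)).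
Qed.

Lemma lift_domain : GRing.integral_domain_axiom A.
Proof.
move=> x y xy; case: eqVneq => //= /unif_factor[n [z [xE z0]]]; apply/eqP.
apply: (lift_mulI z0); elim: n x xy xE => [|n IHn] x xy xE.
  by rewrite -xy xE mul1r.
apply: (IHn (T ^+ n * z)) => //; apply: (unifI (s:=L)).
by rewrite -xy xE exprS !mulrA.
Qed.

End StrictLift.

(** * Power series *)

Section FpsLift.
Context (V : comNzRingType).
Implicit Types f g : fps V.

Definition fps_const (a : V) : fps V := Fps (fun n => if n == 0%N then a else 0).
Definition fps_X : fps V := Fps (fun n => (n == 1%N)%:R).
Definition fps_head f : V := fps_coef f 0.

Lemma fps_coefD f g n : fps_coef (f + g) n = fps_coef f n + fps_coef g n.
Proof. by []. Qed.

Lemma fps_coefM f g n :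
  fps_coef (f * g) n = \sum_(i < n.+1) fps_coef f i * fps_coef g (n - i).
Proof. by []. Qed.

Fact fps_head_zmod : zmod_morphism fps_head.
Proof. by []. Qed.

Fact fps_head_monoid : monoid_morphism fps_head.
Proof.
split=> [//|f g]; rewrite /fps_head fps_coefM big_ord1; exact: erefl.
Qed.

HB.instance Definition _ :=
  GRing.isZmodMorphism.Build (fps V) V fps_head fps_head_zmod.
HB.instance Definition _ :=
  GRing.isMonoidMorphism.Build (fps V) V fps_head fps_head_monoid.

Lemma fps_coefXM f n :
  fps_coef (fps_X * f) n = if n is m.+1 then fps_coef f m else 0.
Proof.
rewrite fps_coefM; case: n => [|n]; first by rewrite big_ord1 mul0r.
rewrite big_ord_recl big_ord_recl /= mul0r add0r mul1r subSS subn0 big1 ?addr0 //.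
by move=> i _; rewrite mul0r.
Qed.

Lemma fps_coef_constM a f n : fps_coef (fps_const a * f) n = a * fps_coef f n.
Proof.
rewrite fps_coefM big_ord_recl /= subn0 big1 ?addr0 // => i _.
by rewrite mul0r.
Qed.

Definition fps_strict_lift : strict_lift V (fps V).
Proof.
apply: (@StrictLift V (fps V) fps_X fps_head fps_const) => //.
- by apply: fpsP => -[].
- move=> a b; apply: fpsP => n; rewrite fps_coef_constM /=.
  by case: eqP => // _; rewrite mulr0.
- move=> f f0; exists (Fps (fun n => fps_coef f n.+1)); apply: fpsP => n.
  by rewrite fps_coefXM; case: n.
- move=> f Xf; apply: fpsP => n.
  by have := congr1 (fun g => fps_coef g n.+1) Xf; rewrite fps_coefXM.
(* Coefficient [n] of [E i] is coefficient [n - 1] of [E i.+1], so the induction has to treat all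
   [i] at once; [m] bounds [n]. *)
- move=> E EX; apply: fpsP => n; move: {2}n (leqnn n) 0%N => m; move: n.
  elim: m => [|m IHm] n nm i; rewrite EX fps_coefXM; case: n nm => // n nm.
  exact: IHm.
- move=> a; exists (fun i => Fps (fun n => a (i + n)%N)) => i.
  apply: fpsP => n; rewrite fps_coefD fps_coefXM /=.
  by case: n => [|n] /=; rewrite ?addn0 ?addr0 // add0r addnS addSn.
Defined.

End FpsLift.

(** * Witt vectors *)

Section WittLift.
Context (p : nat) (p_pr : prime p).

Section Operations.
Context (A : comNzRingType).
Implicit Types x y : witt p_pr A.

Definition witt_teich (a : A) : witt p_pr A :=
  Witt p_pr (fun n => if n == 0%N then a else 0).
Definition witt_ver x : witt p_pr A :=
  Witt p_pr (fun n => if n is m.+1 then witt_coef x m else 0).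
Definition witt_tail x : witt p_pr A := Witt p_pr (fun n => witt_coef x n.+1).
(** The coefficientwise power agrees with the Frobenius of Witt vectors in characteristic [p]; over
    other rings it is only an auxiliary map. *)
Definition witt_frob x : witt p_pr A := Witt p_pr (fun n => witt_coef x n ^+ p).
Definition witt_head x : A := witt_coef x 0.

Lemma wittP x y : witt_coef x =1 witt_coef y -> x = y.
Proof. by case: x y => x [y] /= /funext ->. Qed.

Let p_neq0 n : (p ^ n)%N == 0%N = false.
Proof. by rewrite expn_eq0 -[p == 0%N]negbK -lt0n prime_gt0. Qed.

Lemma witt_ghost_teich a n : witt_ghost (witt_teich a) n = a ^+ (p ^ n).
Proof.
rewrite /witt_ghost /ghost big_ord_recl /= subn0 big1 ?addr0 // => i _.
by rewrite expr0n p_neq0 mul0rn.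
Qed.

Lemma witt_ghost_ver0 x : witt_ghost (witt_ver x) 0 = 0.
Proof. by rewrite /witt_ghost /ghost big_ord1 /= expr1 mul0rn. Qed.

Lemma witt_ghost_verS x n :
  witt_ghost (witt_ver x) n.+1 = witt_ghost x n *+ p.
Proof.
rewrite /witt_ghost /ghost big_ord_recl /= expr0n p_neq0 mul0rn add0r.
rewrite -sumrMnl; apply: eq_bigr => i _.
by rewrite /bump add1n subSS -mulrnA expnSr.
Qed.

Lemma witt_ghostMn x m n : witt_ghost (x *+ m) n = witt_ghost x n *+ m.
Proof.
elim: m => [|m IHm]; first by rewrite !mulr0n; exact: witt_ghost0.
by rewrite !mulrS -IHm; exact: witt_ghostD.
Qed.

Lemma witt_ghost_head x : witt_ghost x 0 = witt_head x.
Proof. by rewrite /witt_ghost /ghost big_ord1 subnn expr1 expn0 mulr1n. Qed.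

Fact witt_head_zmod : zmod_morphism witt_head.
Proof.
move=> x y; rewrite -!witt_ghost_head.
transitivity (witt_ghost x 0 + witt_ghost (- y) 0); first exact: witt_ghostD.
by congr (_ + _); exact: witt_ghostN.
Qed.

Fact witt_head_monoid : monoid_morphism witt_head.
Proof.
split=> [//|x y]; rewrite -!witt_ghost_head; exact: witt_ghostM.
Qed.

HB.instance Definition _ :=
  GRing.isZmodMorphism.Build (witt p_pr A) A witt_head witt_head_zmod.
HB.instance Definition _ :=
  GRing.isMonoidMorphism.Build (witt p_pr A) A witt_head witt_head_monoid.

Hypothesis mulnI : forall n (x y : A), (0 < n)%N -> x *+ n = y *+ n -> x = y.

Lemma witt_ghostI x y : witt_ghost x =1 witt_ghost y -> x = y.
Proof. by case: x y => x [y] /(ghost_inj p_pr mulnI) /= ->. Qed.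

(** By induction the earlier coefficients agree modulo [p], so their contributions to the ghost
    component agree modulo [p ^ n.+1]. What remains is a congruence between the [n]th coefficients
    times [p ^ n], and torsion-freeness cancels that power. *)
Lemma witt_ghost_cong x y :
  (forall n, cong (p ^ n.+1) (witt_ghost x n) (witt_ghost y n)) ->
  forall n, cong p (witt_coef x n) (witt_coef y n).
Proof.
move=> xy; elim/ltn_ind => n IHn; have := xy n.
rewrite /witt_ghost /ghost !big_ord_recr /= subnn !expr1.
set sx := \sum_(i < n) _; set sy := \sum_(i < n) _.
have sxy : cong (p ^ n.+1) sx sy.
  apply: cong_sum => i.
  have -> : (p ^ n.+1 = p ^ (1 + (n - i)) * p ^ i)%N.
    by rewrite -expnD -addnA subnK // ltnW.
  by apply: congMn; apply: congXpn; rewrite expn1; exact: IHn.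
move=> /congD /(_ (congN sxy)) [z]; rewrite [_ + _ - sx]addrC addKr.
rewrite [sy + _ - sy]addrC addKr -mulrnBl expnS mulrnA => zE.
by exists z; apply: mulnI zE; rewrite expn_gt0 prime_gt0.
Qed.

End Operations.

(** * Witt vector identities by descent from torsion-free rings *)

Section Descent.
Context (A B : comNzRingType) (h : {rmorphism B -> A}).
Hypothesis mulnI : forall n (x y : B), (0 < n)%N -> x *+ n = y *+ n -> x = y.
Hypothesis h_surj : forall a, exists b, a = h b.
Implicit Types x : witt p_pr A.

Local Notation mapW := (@witt_map _ p_pr _ _ h).

Let lift_witt x : exists y : witt p_pr B, x = mapW y.
Proof.
have [y yE] := choice (fun n => h_surj (witt_coef x n)).
by exists (Witt p_pr y); apply: wittP => n; rewrite /= yE.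
Qed.

Let map_teich b : mapW (witt_teich b) = witt_teich (h b).
Proof. by apply: wittP => -[|n] //=; rewrite rmorph0. Qed.

Let map_ver y : mapW (witt_ver y) = witt_ver (mapW y).
Proof. by apply: wittP => -[|n] //=; rewrite rmorph0. Qed.

Fact descend_teichM : {morph @witt_teich A : a b / a * b}.
Proof.
move=> a b; have [c ->] := h_surj a; have [d ->] := h_surj b.
rewrite -rmorphM -!map_teich.
transitivity (mapW (witt_teich c * witt_teich d)).
  congr witt_map; apply: (witt_ghostI mulnI) => n.
  transitivity (witt_ghost (witt_teich c) n * witt_ghost (witt_teich d) n).
    by rewrite !witt_ghost_teich exprMn.
  by symmetry; exact: witt_ghostM.
exact: witt_mapM.
Qed.

Fact descend_decomp x : x = witt_teich (witt_head x) + witt_ver (witt_tail x).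
Proof.
have [y ->] := lift_witt x.
have -> : witt_head (mapW y) = h (witt_head y) by [].
have -> : witt_tail (mapW y) = mapW (witt_tail y) by [].
rewrite -map_teich -map_ver.
transitivity (mapW (witt_teich (witt_head y) + witt_ver (witt_tail y))).
  congr witt_map; apply: (witt_ghostI mulnI) => n.
  transitivity (witt_ghost (witt_teich (witt_head y)) n +
                witt_ghost (witt_ver (witt_tail y)) n); last first.
    by symmetry; exact: witt_ghostD.
  rewrite witt_ghost_teich; case: n => [|n].
    by rewrite witt_ghost_ver0 addr0 witt_ghost_head expr1.
  rewrite witt_ghost_verS /witt_ghost /ghost big_ord_recl /=; congr (_ + _).
  rewrite -sumrMnl; apply: eq_bigr => i _.
  by rewrite /bump add1n subSS -mulrnA expnSr.
exact: witt_mapD.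
Qed.

(** Over [B] the two sides differ, but their ghost components at [m.+1] differ by [p ^ m.+2] times a
    coefficient. By [witt_ghost_cong] their coefficients then agree modulo [p], which [h] sends to
    0. *)
Fact descend_mulp x : p \in [pchar A] -> x *+ p = witt_ver (witt_frob x).
Proof.
move=> charA; have [y ->] := lift_witt x.
have -> : witt_frob (mapW y) = mapW (witt_frob y).
  by apply: wittP => n /=; rewrite rmorphXn.
rewrite -map_ver; have -> m : mapW y *+ m = mapW (y *+ m).
  elim: m => [|m IHm]; first by rewrite !mulr0n; symmetry; exact: witt_map0.
  by rewrite !mulrS IHm; symmetry; exact: witt_mapD.
apply: wittP => n /=; have [|z] := @witt_ghost_cong _ mulnI
    (y *+ p) (witt_ver (witt_frob y)) _ n; last first.
  move=> /(congr1 h); rewrite rmorphB rmorphMn /= -[h z *+ p]mulr_natr.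
  by rewrite (pcharf0 charA) mulr0 => /eqP; rewrite subr_eq0 => /eqP.
case=> [|m].
  rewrite witt_ghost_ver0 witt_ghostMn expn1; exact: cong0.
rewrite witt_ghost_verS witt_ghostMn; exists (witt_coef y m.+1).
rewrite /witt_ghost /ghost big_ord_recr /= subnn expr1 mulrnDl -mulrnA -expnSr.
rewrite addrAC [X in X - _](_ : _ = ghost p (fun n => witt_coef y n ^+ p) m *+ p).
  by rewrite subrr add0r.
congr (_ *+ _); apply: eq_bigr => i _.
by rewrite -exprM -expnS subSn // -ltnS.
Qed.

End Descent.

Section Consequences.
Context (A : comNzRingType).
Implicit Types x : witt p_pr A.

Let zeval_surj (a : A) : exists f : zpoly A, a = zeval id f.
Proof. by exists (zvar a); rewrite zeval_var. Qed.

Lemma witt_teich1 : witt_teich (1 : A) = 1.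
Proof. by apply: wittP => -[|n]. Qed.

Lemma witt_teichM : {morph @witt_teich A : a b / a * b}.
Proof. exact: descend_teichM (@zpoly_mulnI A) zeval_surj. Qed.

Lemma witt_decomp x : x = witt_teich (witt_head x) + witt_ver (witt_tail x).
Proof. exact: descend_decomp (@zpoly_mulnI A) zeval_surj x. Qed.

Lemma witt_mulp x : p \in [pchar A] -> x *+ p = witt_ver (witt_frob x).
Proof. exact: descend_mulp (@zpoly_mulnI A) zeval_surj x. Qed.

End Consequences.

(** Multiplication by [p] is Verschiebung after Frobenius; bijectivity of the [p]th power makes it
    injective with image the vectors of head 0. *)
Definition witt_strict_lift (V : comNzRingType) (charV : p \in [pchar V])
  (frob_bij : bijective (fun a : V => a ^+ p)) : strict_lift V (witt p_pr V).
Proof.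
have mulp (x : witt p_pr V) : p%:R * x = witt_ver (witt_frob x).
  by rewrite mulr_natl witt_mulp.
have frobI := bij_inj frob_bij.
have frob0 (a : V) : a ^+ p = 0 -> a = 0.
  by move=> ap; apply: frobI; rewrite ap expr0n gtn_eqF ?prime_gt0.
apply: (@StrictLift V (witt p_pr V) p%:R (@witt_head V) (@witt_teich V)).
- exact: witt_teich1.
- exact: witt_teichM.
- by [].
- by rewrite rmorph_nat; exact: pcharf0.
- move=> x x0; case: frob_bij => g _ gK.
  exists (Witt p_pr (fun n => g (witt_coef x n.+1))); rewrite mulp.
  by apply: wittP => -[|n] //=; rewrite gK.
- move=> x; rewrite mulp => x0; apply: wittP => n.
  by apply: frob0; exact: (congr1 (fun y => witt_coef y n.+1) x0).
- move=> E EX; apply: wittP => n; move: {2}n (leqnn n) 0%N => m; move: n.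
  elim: m => [|m IHm] n nm i; rewrite EX mulp; case: n nm => //= n nm.
  by rewrite IHm // expr0n gtn_eqF ?prime_gt0.
- (* (b_0, b_1 ^ p, b_2 ^ (p ^ 2), ...) is the sum of the p ^ n [b_n]. *)
  move=> a; exists (fun i => Witt p_pr (fun n => a (i + n)%N ^+ (p ^ n))) => i.
  rewrite mulp [LHS]witt_decomp; congr (_ + _).
    by congr witt_teich; rewrite /witt_head /= addn0 expr1.
  apply: wittP => -[|n] //=.
  by rewrite -exprM -expnSr addnS addSn.
Defined.

End WittLift.

(** * Valuations *)

Section ValuationTheory.
Context (R : realType) (K : fieldType) (v : valuation R K).
Implicit Types (x y : K) (r s : R).

(* Junk value: ord 0 = 0. *)
Definition ord x : R := fine (v x).

Lemma val0 : v 0 = +oo%E. Proof. exact/val_eq_pinfty. Qed.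

Lemma ordE x : x != 0 -> v x = (ord x)%:E.
Proof.
move=> /eqP x0; rewrite /ord; have := @val_ninfty _ _ v x.
by have := val_eq_pinfty v x; case: (v x) => // - [/(_ erefl)/x0].
Qed.

Lemma leord r x : x != 0 -> (r%:E <= v x)%E = (r <= ord x).
Proof. by move=> /ordE ->; rewrite lee_fin. Qed.

Lemma ord_eqP r x : x != 0 -> v x = r%:E -> ord x = r.
Proof. by move=> x0 xr; rewrite /ord xr. Qed.

Lemma le_valW r s x : r <= s -> (s%:E <= v x)%E -> (r%:E <= v x)%E.
Proof. by move=> rs; apply: le_trans; rewrite lee_fin. Qed.

Lemma le_valD r x y : (r%:E <= v x -> r%:E <= v y -> r%:E <= v (x + y)%R)%E.
Proof. by move=> rx ry; apply: le_trans (Defs.valD v x y); rewrite le_min rx. Qed.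

Lemma le_valM r s x y :
  (r%:E <= v x -> s%:E <= v y -> (r + s)%:E <= v (x * y)%R)%E.
Proof. by move=> rx sy; rewrite Defs.valM EFinD; exact: leeD. Qed.

Lemma val_opp x : v (- x) = v x.
Proof. by rewrite -mulN1r Defs.valM Defs.valN1 add0e. Qed.

Lemma le_valB r x y : (r%:E <= v x -> r%:E <= v y -> r%:E <= v (x - y)%R)%E.
Proof. by move=> rx ry; apply: le_valD; rewrite ?val_opp. Qed.

Lemma val_distC x y : v (x - y) = v (y - x).
Proof. by rewrite -val_opp opprB. Qed.

Lemma le_val_trans r y x z :
  (r%:E <= v (x - y)%R -> r%:E <= v (y - z)%R -> r%:E <= v (x - z)%R)%E.
Proof. by move=> xy yz; rewrite -(subrKA y); exact: le_valD. Qed.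

Lemma ordM x y : x != 0 -> y != 0 -> ord (x * y) = ord x + ord y.
Proof.
move=> x0 y0; apply: ord_eqP; first by rewrite mulf_neq0.
by rewrite Defs.valM !ordE.
Qed.

Lemma ord_one : ord 1 = 0. Proof. by rewrite /ord Defs.val1. Qed.

Lemma ordV x : x != 0 -> ord x^-1 = - ord x.
Proof.
move=> x0; apply/eqP; rewrite -subr_eq0 opprK -ordM ?invr_eq0 //.
by rewrite mulVf // ord_one.
Qed.

Lemma ordX x n : x != 0 -> ord (x ^+ n) = ord x *+ n.
Proof.
move=> x0; elim: n => [|n IHn]; first by rewrite ord_one.
by rewrite exprS mulrS ordM ?expf_neq0 // IHn.
Qed.

Lemma ordN x : ord (- x) = ord x. Proof. by rewrite /ord val_opp. Qed.

(** If [x + y] had larger valuation than [x], then so would [x = (x + y) - y]. The inequality is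
    assumed only for [y != 0] because of the junk value at 0. *)
Lemma ordDl x y : x != 0 -> (y != 0 -> ord x < ord y) ->
  x + y != 0 /\ ord (x + y) = ord x.
Proof.
move=> x0; have [-> _|y0 /(_ isT) xy] := eqVneq y 0; first by rewrite addr0.
have xy0 : x + y != 0.
  apply: contraTneq xy => /eqP; rewrite addr_eq0 => /eqP ->.
  by rewrite ordN ltxx.
split=> //; apply/eqP; rewrite eq_le; apply/andP; split.
  rewrite leNgt; apply/negP => xxy.
  have := @le_valB (Num.min (ord (x + y)) (ord y)) (x + y) y.
  by rewrite addrK !leord // ge_min lexx ge_min lexx orbT => /(_ isT isT);
    rewrite leNgt lt_min xxy xy.
have := @le_valD (ord x) x y; rewrite !leord // lexx; apply => //; exact: ltW.
Qed.

Local Notation V := (val_ring v).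
Implicit Types (a b c : V).

Lemma val_ring_inj a b : a = b :> K -> a = b.
Proof. by move=> ab; apply: val_inj. Qed.

Lemma val_ring_ge0 a : (0 <= v a)%E.
Proof. by case: a. Qed.

Lemma val_ring_lift x : (0 <= v x)%E -> exists a : V, a = x :> K.
Proof. by move=> x0; exists (ValRing x0). Qed.

Lemma val_ring0 : (0 : V) = 0 :> K. Proof. exact: (rmorph0 (val : V -> K)). Qed.
Lemma val_ring1 : (1 : V) = 1 :> K. Proof. exact: (rmorph1 (val : V -> K)). Qed.
Lemma val_ringD a b : (a + b : V) = (a : K) + (b : K) :> K.
Proof. exact: (rmorphD (val : V -> K)). Qed.
Lemma val_ringB a b : (a - b : V) = (a : K) - (b : K) :> K.
Proof. exact: (rmorphB (val : V -> K)). Qed.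
Lemma val_ringM a b : (a * b : V) = (a : K) * (b : K) :> K.
Proof. exact: (rmorphM (val : V -> K)). Qed.
Lemma val_ringX a n : (a ^+ n : V) = (a : K) ^+ n :> K.
Proof. exact: (rmorphXn (val : V -> K)). Qed.

Lemma val_ring_eq0 a : ((a : K) == 0) = (a == 0).
Proof. by rewrite -val_ring0; apply/eqP/eqP => [/val_ring_inj|->]. Qed.

Lemma val_ring_domain : GRing.integral_domain_axiom V.
Proof.
move=> a b /(congr1 (fun c : V => (c : K))) /eqP.
by rewrite val_ringM val_ring0 mulf_eq0 !val_ring_eq0.
Qed.

Lemma val_ring_mulf_neq0 a b : a != 0 -> b != 0 -> a * b != 0.
Proof. by rewrite -!val_ring_eq0 val_ringM; exact: mulf_neq0. Qed.

Lemma ord_ge0 a : 0 <= ord a.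
Proof. by apply: fine_ge0; exact: val_ring_ge0. Qed.

Lemma val_ring_dvd a b : a != 0 -> (b != 0 -> ord a <= ord b) ->
  exists c, b = c * a.
Proof.
rewrite -val_ring_eq0 => a0 ab; have [->|b0] := eqVneq b 0.
  by exists 0; rewrite mul0r.
have {}ab := ab b0; rewrite -val_ring_eq0 in b0.
have [|c cE] := @val_ring_lift ((b : K) / (a : K)).
  by rewrite leord ?mulf_neq0 ?invr_eq0 // ordM ?invr_eq0 // ordV // subr_ge0.
by exists c; apply: val_ring_inj; rewrite val_ringM cE divfK.
Qed.

Hypothesis v_surj : val_group_full v.

Lemma ord_surj r : exists2 x, x != 0 & ord x = r.
Proof.
have : range (@EFin R) r%:E by exists r.
by rewrite -v_surj => -[x /= x0 xr]; exists x => //; exact: ord_eqP.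
Qed.

Lemma val_ring_surj r : 0 <= r -> exists2 a : V, a != 0 & ord a = r.
Proof.
move=> r0; have [x x0 xr] := ord_surj r.
have [|a ax] := @val_ring_lift x; first by rewrite leord // xr.
by exists a; rewrite -?val_ring_eq0 ax.
Qed.

End ValuationTheory.

(** * Kernels over a strict lift *)

Section Kernels.
Context (V A : comNzRingType) (L : strict_lift V A).
Local Notation T := (unif L).
Local Notation res := (res L).
Local Notation tau := (teich L).

Lemma row_series n (y : nat -> 'rV[A]_n) :
  exists Y : nat -> 'rV[A]_n, forall i, Y i = y i + T *: Y i.+1.
Proof.
have /choice[Y YE] (j : 'I_n) := unif_series L (fun i => y i 0 j).
exists (fun i => \row_j Y j i) => i; apply/rowP => j.
by rewrite !mxE YE.
Qed.

Lemma row_sep n (E : nat -> 'rV[A]_n) :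
  (forall i, E i = T *: E i.+1) -> E 0%N = 0.
Proof.
move=> ET; apply/rowP => j; rewrite mxE.
by apply: (unif_sep (s := L) (E := fun i => E i 0 j)) => i; rewrite ET mxE.
Qed.

Lemma row_res_eq n (x y : 'rV[A]_n) :
  map_mx res x = map_mx res y -> exists z, x = y + T *: z.
Proof.
move=> xy; have /choice[z zE] (j : 'I_n) : exists z, x 0 j = y 0 j + T * z.
  by apply: res_eq; move/rowP: xy => /(_ j); rewrite !mxE.
by exists (\row_j z j); apply/rowP => j; rewrite !mxE.
Qed.

Lemma map_res_teich m n (x : 'M[V]_(m, n)) : map_mx res (map_mx tau x) = x.
Proof. by apply/matrixP => i j; rewrite !mxE res_teich. Qed.

Section Kernel.
Context (n : nat) (a : 'cV[A]_n).

Definition residue_kernel : set 'rV[V]_n :=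
  [set y | exists2 x : 'rV[A]_n, x *m a = 0 & map_mx res x = y].

Lemma kernel_unifI (x : 'rV[A]_n) : (T *: x) *m a = 0 -> x *m a = 0.
Proof.
rewrite -scalemxAl => xa; apply/matrixP => i j.
have /matrixP/(_ i j) := xa; rewrite !mxE; exact: unifI.
Qed.

Lemma kernelD (x y : 'rV[A]_n) (b : A) :
  x *m a = 0 -> y *m a = 0 -> (b *: x + y) *m a = 0.
Proof. by move=> xa ya; rewrite mulmxDl -scalemxAl xa ya scaler0 addr0. Qed.

Lemma kernel_series (y Y : nat -> 'rV[A]_n) :
  (forall i, y i *m a = 0) -> (forall i, Y i = y i + T *: Y i.+1) ->
  Y 0%N *m a = 0.
Proof.
move=> ya YE; apply/matrixP => i j; rewrite !ord1 [RHS]mxE {i j}.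
apply: (unif_sep (s := L) (E := fun i => (Y i *m a) 0 0)) => i.
by rewrite YE mulmxDl ya add0r -scalemxAl mxE.
Qed.

(* Topological Nakayama. *)
Lemma kernel_generators m (S : 'M[A]_(m, n)) :
  S *m a = 0 ->
  (forall y, residue_kernel y -> exists b, y = b *m map_mx res S) ->
  forall x : 'rV[A]_n, x *m a = 0 -> exists b, x = b *m S.
Proof.
move=> Sa gen.
have step (x : 'rV[A]_n) : exists bz : 'rV[A]_m * 'rV[A]_n, x *m a = 0 ->
    x = bz.1 *m S + T *: bz.2 /\ bz.2 *m a = 0.
  have [xa|] := pselect (x *m a = 0); last by exists (0, 0).
  have [|b bE] := gen (map_mx res x); first by exists x.
  have [|z zE] := @row_res_eq _ x (map_mx tau b *m S).
    by rewrite map_mxM map_res_teich.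
  exists (map_mx tau b, z) => _; split=> //=; apply: kernel_unifI.
  have -> : T *: z = x - map_mx tau b *m S by rewrite zE addrC addKr.
  by rewrite mulmxBl xa -mulmxA Sa mulmx0 subrr.
have [f fP] := choice step; move=> x xa.
(* [X i] is the remainder after [i] corrections, already divided by [T ^ i]; [B] sums the
   coefficient rows of the corrections. *)
pose X := fix X i := if i is j.+1 then (f (X j)).2 else x.
have Xa i : X i *m a = 0 by elim: i => //= i /fP[].
have [B BE] := row_series (fun i => (f (X i)).1).
exists (B 0%N); apply/eqP; rewrite -subr_eq0; apply/eqP.
apply: (row_sep (E := fun i => X i - B i *m S)) => i.
rewrite [Z in Z - _](fP _ (Xa i)).1.
by rewrite BE mulmxDl -scalemxAl scalerBr opprD addrACA subrr add0r.
Qed.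

(** * Telescoping systems over a strict lift *)

Section Divisible.
Context (c d : nat -> V).

(* For c k = d k * c k.+1, this says that Ext^1 vanishes from the union of the
   c k ^-1 V to M, in terms of cochains. *)
Definition telescope_solvable m (M : set 'rV[V]_m) := forall z : nat -> 'rV[V]_m,
  (forall k, M (z k)) ->
  exists w, forall k, M (w k) /\ w k = d k *: w k.+1 - z k.

(** When [c k = d k * c k.+1] in a domain, such a sequence is one vector [x k / c k] over the
    fraction field that every [c k] multiplies into [M]; closedness puts this vector in [M]. *)
Definition telescope_closed m (M : set 'rV[V]_m) := forall x : nat -> 'rV[V]_m,
  (forall k, M (x k)) -> (forall k, x k = d k *: x k.+1) ->
  exists2 e, M e & forall k, x k = c k *: e.

(** A solution modulo [T], lifted to relations, leaves an error [T *: y] with [y] again made of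
    relations. Solving next for [y] and summing the solutions with powers of [T] removes the
    error. *)
Lemma kernel_solvable : telescope_solvable residue_kernel ->
  forall z : nat -> 'rV[A]_n, (forall k, z k *m a = 0) ->
  exists w : nat -> 'rV[A]_n, forall k,
    w k *m a = 0 /\ w k = tau (d k) *: w k.+1 - z k.
Proof.
move=> sol.
have step (z : nat -> 'rV[A]_n) :
    exists wz : (nat -> 'rV[A]_n) * (nat -> 'rV[A]_n),
    (forall k, z k *m a = 0) -> forall k,
    [/\ wz.1 k *m a = 0, wz.2 k *m a = 0 &
        wz.1 k = tau (d k) *: wz.1 k.+1 - z k + T *: wz.2 k].
  have [za|] := pselect (forall k, z k *m a = 0); last by exists (z, z).
  have [|w' w'P] := sol (fun k => map_mx res (z k)); first by move=> k; exists (z k).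
  have /choice[w wP] k : exists w : 'rV[A]_n, w *m a = 0 /\ map_mx res w = w' k.
    by have [[w]] := w'P k; exists w.
  have /choice[y yP] k : exists y : 'rV[A]_n,
      w k = tau (d k) *: w k.+1 - z k + T *: y.
    apply: row_res_eq; rewrite map_mxD map_mxN map_mxZ !(wP _).2 res_teich.
    exact: (w'P k).2.
  exists (w, y) => _ k; split=> //=; first exact: (wP k).1.
  apply: kernel_unifI.
  have -> : T *: y k = w k - (tau (d k) *: w k.+1 - z k).
    by rewrite {1}yP addrC addKr.
  by rewrite !mulmxBl -scalemxAl !(wP _).1 za scaler0 !subr0.
have [f fP] := choice step; move=> z za.
pose Z := fix Z i := if i is j.+1 then (f (Z j)).2 else z.
have Za i : forall k, Z i k *m a = 0.
  by elim: i => //= i IHi k; have [] := fP _ IHi k.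
have /choice[W WE] k := row_series (fun i => (f (Z i)).1 k).
exists (fun k => W k 0%N) => k; split.
  apply: kernel_series (WE k) => i.
  by have [] := fP _ (Za i) k.
apply/eqP; rewrite -subr_eq0; apply/eqP.
apply: (row_sep (E := fun i => W k i - (tau (d k) *: W k.+1 i - Z i k))) => i.
have [_ _ fE] := fP _ (Za i) k; rewrite (WE k i) (WE k.+1 i) fE /=.
apply/rowP => j; rewrite !mxE; ring.
Qed.

Hypothesis c_dvd : forall x : nat -> V, (forall k, x k = d k * x k.+1) ->
  exists e, forall k, x k = c k * e.
Hypothesis cE : forall k, c k = d k * c k.+1.

(** The vector [e] is found digit by digit. Multiplicativity of [tau] carries [cE] over to [A], so
    after subtracting a digit the remainder divided by [T] satisfies the same recursion. *)
Lemma lift_telescope (x : nat -> 'rV[A]_n) :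
  (forall k, x k = tau (d k) *: x k.+1) ->
  exists e, forall k, x k = tau (c k) *: e.
Proof.
have step (y : nat -> 'rV[A]_n) : exists ez : 'rV[A]_n * (nat -> 'rV[A]_n),
    (forall k, y k = tau (d k) *: y k.+1) -> forall k,
    y k = tau (c k) *: ez.1 + T *: ez.2 k /\
    ez.2 k = tau (d k) *: ez.2 k.+1.
  have [yE|] := pselect (forall k, y k = tau (d k) *: y k.+1); last by exists (0, y).
  have /choice[e eE] (j : 'I_n) : exists e, forall k, res (y k 0 j) = c k * e.
    by apply: c_dvd => k; rewrite yE mxE rmorphM res_teich.
  have /choice[z zE] k : exists z,
      y k = tau (c k) *: (\row_j tau (e j)) + T *: z.
    by apply: row_res_eq; apply/rowP => j; rewrite !mxE rmorphM !res_teich eE.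
  exists (\row_j tau (e j), z) => _ k; split=> //=.
  apply/rowP => j; rewrite [RHS]mxE; apply: (unif_mulI (L := L)).
  have := congr1 (fun u : 'rV[A]_n => u 0 j) (yE k).
  rewrite /= (zE k) (zE k.+1) (cE k) teichM !mxE mulrDr mulrA => /addrI ->.
  by rewrite mulrCA.
have [f fP] := choice step; move=> xE.
pose X := fix X i := if i is j.+1 then (f (X j)).2 else x.
have XE i : forall k, X i k = tau (d k) *: X i k.+1.
  by elim: i => //= i IHi k; have [] := fP _ IHi k.
have [E EE] := row_series (fun i => (f (X i)).1).
exists (E 0%N) => k; apply/eqP; rewrite -subr_eq0; apply/eqP.
apply: (row_sep (E := fun i => X i k - tau (c k) *: E i)) => i.
rewrite [Z in Z - _](fP _ (XE i) k).1 EE /=.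
apply/rowP => j; rewrite !mxE; ring.
Qed.

Hypothesis c_reg : forall x : A, tau (c 0%N) * x = 0 -> x = 0.

(** Lifts [y k] of [x k] to relations satisfy the recursion up to an error [T *: z k]. Solving the
    telescoping system for [z] gives [w] such that [y k - T *: w k] satisfies it exactly, and the
    resulting [e] is a relation because [tau (c 0)] is regular. *)
Lemma residue_kernel_closed : telescope_solvable residue_kernel ->
  telescope_closed residue_kernel.
Proof.
move=> sol x xM xE.
have /choice[y yP] k : exists y : 'rV[A]_n, y *m a = 0 /\ map_mx res y = x k.
  by have [y] := xM k; exists y.
have /choice[z zE] k : exists z, tau (d k) *: y k.+1 = y k + T *: z.
  by apply: row_res_eq; rewrite map_mxZ !(yP _).2 res_teich -xE.
have [|w wP] := kernel_solvable sol (z := z).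
  move=> k; apply: kernel_unifI; have -> : T *: z k = tau (d k) *: y k.+1 - y k.
    by rewrite zE addrC addKr.
  by rewrite mulmxBl -scalemxAl !(yP _).1 scaler0 subrr.
have [|e eE] := @lift_telescope (fun k => y k - T *: w k).
  move=> k; rewrite [w k](wP k).2 !scalerBr zE.
  apply/rowP => j; rewrite !mxE; ring.
exists (map_mx res e).
  exists e => //; apply/matrixP => i j; rewrite !ord1 [RHS]mxE; apply: c_reg.
  have /(congr1 (fun u => (u *m a) 0 0)) := eE 0%N.
  by rewrite mulmxBl -!scalemxAl (yP _).1 (wP _).1 scaler0 subr0 !mxE.
move=> k; have /(congr1 (map_mx res)) := eE k.
by rewrite map_mxB !map_mxZ (yP _).2 res_unif scale0r subr0 res_teich.
Qed.

End Divisible.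
End Kernel.
End Kernels.

(** * Submodules of V^n over a spherically complete field *)

Section Spherical.
Context (R : realType) (K : fieldType) (v : valuation R K).
Hypothesis v_surj : val_group_full v.
Hypothesis sph : spherically_complete v.
Local Notation V := (val_ring v).
Local Notation ord := (ord v).

Lemma nested_balls (x : nat -> K) (r : nat -> R) :
  (forall k, r k <= r k.+1) -> (forall k, (r k)%:E <= v (x k.+1 - x k)%R)%E ->
  exists s, forall k, ((r k)%:E <= v (s - x k)%R)%E.
Proof.
move=> rS xS.
have rm k i : r k <= r (i + k)%N.
  by elim: i => // i IHi; apply: le_trans IHi _; exact: rS.
have xm k i : ((r k)%:E <= v (x (i + k)%N - x k)%R)%E.
  elim: i => [|i IHi]; first by rewrite subrr val0 leey.
  by apply: (le_val_trans (y := x (i + k)%N)) => //; exact: le_valW (xS _).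
have sub k m : (k <= m)%N ->
    val_closed_ball v (x m) (r m) `<=` val_closed_ball v (x k) (r k).
  move=> /subnK <- y ym; apply: (le_val_trans (y := x (m - k + k)%N)) => //.
  exact: le_valW ym.
have [||s sP] := sph (F := [set B | exists k, B = val_closed_ball v (x k) (r k)]).
- by move=> B [k ->]; exists (x k), (r k).
- move=> B C [k ->] [m ->]; have [km|/ltnW mk] := leqP k m.
    by right; exact: sub.
  by left; exact: sub.
by exists s => k; apply: (sP (val_closed_ball v (x k) (r k))); exists k.
Qed.

Context (c d : nat -> V).
Hypothesis c_neq0 : forall k, c k != 0.
Hypothesis c_ord : forall k, ord (c k.+1) < ord (c k).
Hypothesis cE : forall k, c k = d k * c k.+1.

(** Over [K] the solutions are [c k * (t + s k)] with [s k] the sum of the [z i / c i] for [i < k],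
    and [t] is free. If [l] is the infimum of the valuations on [J], then [J] contains everything of
    valuation above [l], so it is enough that [t] lies in a nested sequence of balls. *)
Lemma ideal_solvable (J : set V) (z : nat -> V) :
  J 0 -> (forall b x y, J x -> J y -> J (b * x + y)) -> (forall k, J (z k)) ->
  exists w, forall k, J (w k) /\ w k = d k * w k.+1 - z k.
Proof.
move=> J0 JD Jz.
have [Jtriv|] := pselect (forall x, J x -> x = 0).
  by exists (fun=> 0) => k; rewrite (Jtriv _ (Jz k)) mulr0 subr0.
move=> /existsNP[j /not_implyP[Jj /eqP j0]].
pose S := [set ord x | x in [set x : V | J x /\ x != 0]].
have S0 : S !=set0 by exists (ord j), j.
have Slb : has_lbound S by exists 0 => _ [x _ <-]; exact: ord_ge0.
pose l := inf S.
have l_ge0 : 0 <= l by apply: lb_le_inf => // _ [x _ <-]; exact: ord_ge0.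
have lJ x : J x -> (l%:E <= v x)%E.
  move=> Jx; have [->|x0] := eqVneq x 0; first by rewrite val_ring0 val0 leey.
  by rewrite leord ?val_ring_eq0 //; apply: ge_inf => //; exists x.
have Jl x r : l < r -> (r%:E <= v x)%E -> exists2 y : V, J y & y = x :> K.
  move=> lr xr; have [|y yx] := @val_ring_lift _ _ v x.
    by apply: le_valW xr; exact: le_trans (ltW lr).
  exists y => //; have [->//|y0] := eqVneq y 0.
  have /inf_lt[//|_ [u [Ju u0] <-] uy] : l < ord y.
    by apply: lt_le_trans lr _; rewrite -leord ?yx // -yx val_ring_eq0.
  have [||b ->] := @val_ring_dvd _ _ v u y => //; first by move=> _; exact: ltW.
  by rewrite -[_ * _]addr0; exact: JD.
have cK k : (c k : K) != 0 by rewrite val_ring_eq0.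
pose s k := \sum_(i < k) (z i : K) / (c i : K).
have sS k : s k.+1 = s k + (z k : K) / (c k : K) by rewrite /s big_ord_recr.
have [||t tP] := @nested_balls (fun k => - s k.+1) (fun k => l - ord (c k.+1)).
- by move=> k; rewrite lerD2l lerN2 ltW.
- move=> k; rewrite (sS k.+1) opprK opprD addrAC addNr add0r val_opp.
  by apply: le_valM; rewrite ?lJ // leord ?invr_eq0 // ordV.
(* Membership is tested on [w k + z k = c k * (t + s k.+1)], whose valuation exceeds [l] by at least
   [ord (c k) - ord (c k.+1)]. This strict gain makes it irrelevant whether [l] is attained on
   [J]. *)
have /choice[w wP] k : exists w : V, J w /\ (w : K) = (c k : K) * (t + s k).
  have [||y Jy yE] := Jl ((c k : K) * (t + s k.+1)) (ord (c k) + (l - ord (c k.+1))).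
  - by rewrite addrCA ltrDl subr_gt0.
  - by apply: le_valM; [rewrite leord|rewrite -[s _]opprK].
  exists (-1 * z k + y); split; first exact: JD.
  by rewrite mulN1r addrC val_ringB yE sS; field.
exists w => k; split; first exact: (wP k).1.
apply: val_ring_inj; rewrite val_ringB val_ringM !(wP _).2 sS mulrA -val_ringM -cE.
by field.
Qed.

(** With [row_emb] this forms the exact sequence from [V^n] through [V^(1 + n)] to [V], along which
    submodules are reduced by induction to ideals. *)
Definition row_hd n (x : 'rV[V]_(1 + n)) : V := x 0 (lshift n 0).
Definition row_emb n (x : 'rV[V]_n) : 'rV[V]_(1 + n) := row_mx 0 x.

Lemma row_hd_linear n b (x y : 'rV[V]_(1 + n)) :
  row_hd (b *: x + y) = b * row_hd x + row_hd y.
Proof. by rewrite /row_hd !mxE. Qed.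

Lemma row_hdZ n b (x : 'rV[V]_(1 + n)) : row_hd (b *: x) = b * row_hd x.
Proof. by rewrite /row_hd mxE. Qed.

Lemma row_hdB n (x y : 'rV[V]_(1 + n)) : row_hd (x - y) = row_hd x - row_hd y.
Proof. by rewrite /row_hd !mxE. Qed.

Lemma row_hd_emb n (x : 'rV[V]_n) : row_hd (row_emb x) = 0.
Proof. by rewrite /row_hd /row_emb row_mxEl mxE. Qed.

Lemma row_emb_linear n b (x y : 'rV[V]_n) :
  row_emb (b *: x + y) = b *: row_emb x + row_emb y.
Proof. by rewrite /row_emb scale_row_mx add_row_mx scaler0 addr0. Qed.

Lemma row_embN n (x : 'rV[V]_n) : row_emb (- x) = - row_emb x.
Proof. by rewrite /row_emb opp_row_mx oppr0. Qed.

Lemma row_embZ n b (x : 'rV[V]_n) : row_emb (b *: x) = b *: row_emb x.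
Proof. by rewrite /row_emb scale_row_mx scaler0. Qed.

Lemma row_emb_inj n : injective (@row_emb n).
Proof. by move=> x y /eq_row_mx[]. Qed.

Lemma row_hd_eq0 n (x : 'rV[V]_(1 + n)) : row_hd x = 0 -> exists y, x = row_emb y.
Proof.
move=> x0; exists (rsubmx x); rewrite -[LHS]hsubmxK /row_emb; congr row_mx.
by apply/rowP => j; rewrite !ord1 !mxE.
Qed.

Lemma mulmx_hd_emb n m (b : 'rV[V]_(1 + m)) (u : 'rV[V]_(1 + n)) (S : 'M_(m, n)) :
  b *m col_mx u (row_mx 0 S) = row_hd b *: u + row_emb (rsubmx b *m S).
Proof.
rewrite -[b in LHS]hsubmxK mul_row_col {1}[lsubmx b]mx11_scalar.
by rewrite mul_scalar_mx mul_mx_row mulmx0 mxE.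
Qed.

Definition submodule n (M : set 'rV[V]_n) :=
  M 0 /\ forall b x y, M x -> M y -> M (b *: x + y).

Section Slices.
Context (n : nat) (M : set 'rV[V]_(1 + n)).
Hypothesis subM : submodule M.

Lemma submodule_slice : submodule [set y | M (row_emb y)].
Proof.
have [M0 MD] := subM; split=> [|b x y Mx My] /=; first by rewrite /row_emb row_mx0.
by rewrite row_emb_linear; exact: MD.
Qed.

Lemma row_hd_image0 : (@row_hd n @` M) 0.
Proof. by exists 0; [exact: subM.1 | rewrite /row_hd mxE]. Qed.

Lemma row_hd_imageD b x y :
  (@row_hd n @` M) x -> (@row_hd n @` M) y -> (@row_hd n @` M) (b * x + y).
Proof.
by move=> [u Mu <-] [w Mw <-]; exists (b *: u + w); [exact: subM.2|exact: row_hd_linear].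
Qed.

End Slices.

(** Solvability passes to extensions: solve for the heads, lift the solution to [u] in [M], and the
    error, which has head 0, is corrected by solving in the slice. *)
Lemma submodule_solvable n (M : set 'rV[V]_n) :
  submodule M -> telescope_solvable d M.
Proof.
elim: n M => [|n IHn] M subM z Mz.
  exists (fun=> 0) => k; split; first exact: subM.1.
  by rewrite [RHS]thinmx0.
have [MD MB] : (forall b x y, M x -> M y -> M (b *: x + y)) /\
    (forall x y, M x -> M y -> M (x - y)).
  split=> [|x y Mx My]; first exact: subM.2.
  by rewrite addrC -scaleN1r; exact: subM.2.
have [|w wP] := @ideal_solvable (@row_hd n @` M) (fun k => @row_hd n (z k))
  (row_hd_image0 subM)
  (row_hd_imageD subM); first by move=> k; exists (z k).
have /choice[u uP] k : exists u, M u /\ @row_hd n u = w k.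
  by have [[u Mu uw] _] := wP k; exists u.
have /choice[e eP] k : exists e, d k *: u k.+1 - z k - u k = @row_emb n e.
  apply: row_hd_eq0; have -> : d k *: u k.+1 - z k - u k =
    d k *: u k.+1 + ((-1) *: z k + (-1) *: u k) by rewrite !scaleN1r addrA.
  rewrite /row_hd !mxE -!/(row_hd _) !(uP _).2 [w k](wP k).2 /row_hd; ring.
have [|t tP] := IHn _ (submodule_slice subM) (fun k => - e k).
  move=> k /=; have -> : row_emb (- e k) = 0 - (d k *: u k.+1 - z k - u k).
    by rewrite eP sub0r; exact: row_embN.
  apply: (MB _ _ subM.1); apply: (MB _ _ _ (uP k).1); apply: (MB _ _ _ (Mz k)).
  by rewrite -[_ *: _]addr0; exact: MD (uP _).1 subM.1.
exists (fun k => row_emb (t k) + u k); move=> k; split.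
  by rewrite -[row_emb _]scale1r; exact: MD (tP k).1 (uP k).1.
rewrite [t k](tP k).2 opprK row_emb_linear -eP.
by apply/rowP => j; rewrite !mxE; ring.
Qed.

(* An ideal of V that is not principal is open, and then contains every c k * j
   for j at its boundary; telescoping those produces an element of M whose head
   is j. *)
Lemma closed_finitely_generated n (M : set 'rV[V]_n) :
  submodule M -> telescope_closed c d M ->
  exists m (S : 'M[V]_(m, n)), forall x, M x <-> exists b, x = b *m S.
Proof.
elim: n M => [|n IHn] M subM clM.
  exists 0%N, 0 => x; split=> [_|_]; first by exists 0; rewrite [LHS]thinmx0 [RHS]thinmx0.
  by rewrite [x]thinmx0; exact: subM.1.
change (exists m (S : 'M[V]_(m, 1 + n)), forall x : 'rV[V]_(1 + n),
  M x <-> exists b, x = b *m S).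
have [M0 MD] := subM.
have [|m [S SP]] := IHn _ (submodule_slice subM).
  move=> x Mx xE; have [//||e Me eE] := clM (fun k => row_emb (x k)).
    by move=> k; rewrite {1}xE; exact: row_embZ.
  have [|y yE] := @row_hd_eq0 n e.
    have /(congr1 (@row_hd n)) := eE 0%N.
    rewrite row_hd_emb row_hdZ.
    by move/esym/val_ring_domain; rewrite (negPf (c_neq0 0)) => /eqP.
  exists y; first by rewrite /= -yE.
  by move=> k; apply: row_emb_inj; rewrite row_embZ -yE; exact: eE.
have M_emb b : M (row_emb (b *m S)) by apply/SP; exists b.
have [Jtriv|] := pselect (forall x, M x -> row_hd x = 0).
  exists m, (row_mx 0 S : 'M_(m, 1 + n)) => x; rewrite /=; split=> [Mx|[b ->]].
    have [y yE] := row_hd_eq0 (Jtriv _ Mx).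
    have /SP[b bE] : M (row_emb y) by rewrite -yE.
    by exists b; rewrite mul_mx_row mulmx0 -bE.
  by rewrite mul_mx_row mulmx0; exact: M_emb.
move=> /existsNP[x0 /not_implyP[Mx0 /eqP x00]].
pose I := [set ord (row_hd x) | x in [set x | M x /\ row_hd x != 0]].
have I0 : I !=set0 by exists (ord (row_hd x0)), x0.
have Ilb : has_lbound I by exists 0 => _ [x _ <-]; exact: ord_ge0.
have l_ge0 : 0 <= inf I by apply: lb_le_inf => // _ [x _ <-]; exact: ord_ge0.
have [j j0 jl] := val_ring_surj v_surj l_ge0.
have Mj x : M x -> exists b, row_hd x = b * j.
  move=> Mx; apply: val_ring_dvd => // hx0; rewrite jl.
  by apply: ge_inf => //; exists x.
have [u Mu uj] : exists2 u, M u & @row_hd n u = j.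
  (* Strict decrease of [ord (c k)] makes it positive, so [c k * j] lies strictly above the infimum
     and is a multiple of some head. *)
  have /choice[y yP] k : exists y, M y /\ @row_hd n y = c k * j.
    have /inf_lt[//|_ [u [Mu u0] <-] uy] : inf I < ord (c k * j).
      rewrite val_ringM ordM ?val_ring_eq0 // jl ltrDr.
      exact: le_lt_trans (ord_ge0 _) (c_ord k).
    have [//||b ->] := @val_ring_dvd _ _ v (row_hd u) (c k * j).
      by move=> _; exact: ltW.
    by exists (b *: u); rewrite row_hdZ -[_ *: u]addr0; split=> //; exact: MD.
  (* The [y k] telescope only in their heads; solving in the slice adjusts them so that closedness
     of [M] applies. *)
  have /choice[e eP] k : exists e, d k *: y k.+1 - y k = @row_emb n e.
    apply: row_hd_eq0; rewrite row_hdB row_hdZ !(yP _).2 mulrA -cE; exact: subrr.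
  have [|t tP] := submodule_solvable (submodule_slice subM) (z := fun k => - e k).
    move=> k /=; have -> : row_emb (- e k) = (- d k) *: y k.+1 + (1 *: y k + 0).
      by rewrite row_embN -eP opprB scale1r addr0 scaleNr addrC.
    by apply: (MD _ _ _ (yP _).1); exact: MD (yP _).1 M0.
  have [||f Mf fE] := clM (fun k => y k + row_emb (t k)).
  - by move=> k; rewrite -[y k]scale1r; exact: MD (yP k).1 (tP k).1.
  - move=> k; rewrite [t k](tP k).2 opprK row_emb_linear -eP.
    by apply/rowP => i; rewrite !mxE; ring.
  exists f => //; have /(congr1 (@row_hd n)) := fE 0%N.
  rewrite -[y 0%N]scale1r row_hd_linear row_hd_emb addr0 mul1r (yP _).2.
  rewrite row_hdZ => /eqP.
  rewrite -subr_eq0 -mulrBr => /eqP/val_ring_domain.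
  by rewrite (negPf (c_neq0 0)) subr_eq0 => /eqP ->.
exists (1 + m)%N, (col_mx u (row_mx 0 S : 'M_(m, 1 + n))) => x; split=> [Mx|[b ->]].
  have [b bE] := Mj _ Mx.
  have [|y yE] := @row_hd_eq0 n (- b *: u + x).
    by rewrite row_hd_linear uj bE; ring.
  have /SP[b' b'E] : M (row_emb y) by rewrite -yE; exact: MD.
  exists (row_mx b%:M b'); rewrite mul_row_col mul_scalar_mx mul_mx_row mulmx0 -b'E.
  by rewrite -[row_mx 0 y]/(row_emb y) -yE scaleNr addrA subrr add0r.
rewrite (mulmx_hd_emb b u S); apply: MD => //; exact: M_emb.
Qed.

End Spherical.

(** * Coherence and greatest common divisors *)

Section DomainCancel.
Context (A : comNzRingType).
Hypothesis domA : GRing.integral_domain_axiom A.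

Lemma domain_mulI (x y z : A) : x != 0 -> x * y = x * z -> y = z.
Proof.
move=> x0 /eqP; rewrite -subr_eq0 -mulrBr => /eqP/domA.
by rewrite (negPf x0) subr_eq0 => /eqP.
Qed.

Lemma domain_mulf_neq0 (x y : A) : x != 0 -> y != 0 -> x * y != 0.
Proof. by move=> x0 y0; apply/eqP => /domA; rewrite (negPf x0) (negPf y0). Qed.

End DomainCancel.

(* Schanuel: coherence provides some finite system of generators with finitely
   many relations, not necessarily a. *)
Lemma coherent_kernel (A : comNzRingType) n (a : 'cV[A]_n) : coherent A ->
  exists m (S : 'M[A]_(m, n)), S *m a = 0 /\
    forall x : 'rV[A]_n, x *m a = 0 -> exists b, x = b *m S.
Proof.
have ideal_mx n1 n2 (a1 : 'cV[A]_n1) (a2 : 'cV[A]_n2) :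
    ideal_gen a1 = ideal_gen a2 -> exists C : 'M_(n1, n2), a1 = C *m a2.
  move=> a12; have /choice[C CE] (i : 'I_n1) :
      exists c : 'rV[A]_n2, (c *m a2) 0 0 = a1 i 0.
    have : ideal_gen a2 (a1 i 0).
      by rewrite -a12; exists (delta_mx 0 i) => //; rewrite -rowE mxE.
    by case=> c _ cE; exists c.
  exists (\matrix_i C i); apply/matrixP => i j; rewrite ord1 -CE.
  by rewrite [LHS]mxE [RHS]mxE; apply: eq_bigr => k _; rewrite !mxE.
case/(_ (ideal_gen a)); first by exists n, a.
move=> n' [a' [aa' [m [S /seteqP[SP1 SP2]]]]].
have [D DE] := ideal_mx _ _ _ _ aa'; have [C CE] := ideal_mx _ _ _ _ (esym aa').
have Sa : S *m a' = 0.
  apply/row_matrixP => i; rewrite row_mul row0 rowE.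
  by apply: (SP2 (delta_mx 0 i *m S)); exists (delta_mx 0 i).
(* [D] and [C] rewrite the two systems of generators in terms of each other. A relation [x] is the
   sum of [x *m D *m C], coming from a relation of [a'], and [x *m (1 - D *m C)]. *)
exists (m + n)%N, (col_mx (S *m C) (1%:M - D *m C)); split.
  by rewrite mul_col_mx -mulmxA -CE Sa mulmxBl mul1mx -mulmxA -CE -DE subrr col_mx0.
move=> x xa; have [|b _ bE] := SP1 (x *m D); first by rewrite /= -mulmxA -DE.
exists (row_mx b x); rewrite mul_row_col mulmxA bE mulmxBr mulmx1 mulmxA.
by rewrite addrC subrK.
Qed.

Section Lift.
Context (R : realType) (K : fieldType) (v : valuation R K).
Hypothesis v_surj : val_group_full v.
Local Notation V := (val_ring v).
Local Notation ord := (ord v).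
Context (A : comNzRingType) (L : strict_lift V A).

Let domV := @val_ring_domain _ _ v.
Let domA := lift_domain L domV.

Lemma inv_nat_lt (e : R) : 0 < e -> exists k, k.+1%:R^-1 < e.
Proof.
move=> e0; exists (Num.bound e^-1); rewrite invf_plt ?posrE //.
apply: lt_trans (archi_boundP _) _; first by rewrite invr_ge0 ltW.
by rewrite ltr_nat.
Qed.

(** The valuations [1 / (k + 1)] of the [c k] strictly decrease, as solvability needs, and tend to
    0, as [c_dvd] needs. *)
Lemma spherical_coherent : spherically_complete v -> coherent A.
Proof.
move=> sph; have /choice[c cP] (k : nat) : exists c : V, c != 0 /\ ord c = k.+1%:R^-1.
  by have [|c] := val_ring_surj v_surj (r := k.+1%:R^-1); [rewrite invr_ge0|exists c].
have c0 k : c k != 0 := (cP k).1.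
have c_ord k : ord (c k.+1) < ord (c k).
  by rewrite !(cP _).2 ltf_pV2 ?posrE // ltr_nat.
have /choice[d dE] k : exists d, c k = d * c k.+1.
  by apply: val_ring_dvd => // _; exact: ltW.
have c_dvd (x : nat -> V) : (forall k, x k = d k * x k.+1) ->
    exists e, forall k, x k = c k * e.
  move=> xE; have [/eqP x00|x00] := boolP (x 0%N == 0).
    exists 0; elim=> [|k IHk]; first by rewrite mulr0.
    rewrite mulr0; apply: (domain_mulI domV (x := d k)).
      by apply: contraNneq (c0 k) => d0; rewrite dE d0 mul0r.
    by rewrite -xE IHk !mulr0.
  (* All [x k] equal [c k * q], so [ord q] is at least [- ord (c k)] for every [k], hence
     nonnegative. *)
  pose q : K := (x 0%N : K) / (c 0%N : K).
  have cK k : (c k : K) != 0 by rewrite val_ring_eq0.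
  have qE k : (x k : K) = (c k : K) * q.
    elim: k => [|k IHk]; first by rewrite mulrC divfK.
    have dK : (d k : K) != 0.
      by apply: contraTneq (cK k) => d0; rewrite dE val_ringM d0 mul0r eqxx.
    by apply: (mulfI dK); rewrite -val_ringM -xE IHk (dE k) val_ringM -mulrA.
  have q0 : q != 0 by rewrite mulf_neq0 ?invr_eq0 // val_ring_eq0.
  have [|e eq] := @val_ring_lift _ _ v q.
    rewrite leord // leNgt; apply/negP; rewrite -oppr_gt0.
    move=> /inv_nat_lt[m]; rewrite -(cP m).2 => qm.
    have := ord_ge0 (x m); rewrite qE ordM //; lra.
  by exists e => k; apply: val_ring_inj; rewrite val_ringM eq qE.
move=> I [n [a IE]]; exists n, a; split=> //.
have subM : submodule (residue_kernel L a).
  split=> [|b x y [x' xa <-] [y' ya <-]].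
    by exists 0; [rewrite mul0mx|rewrite map_mx0].
  exists (teich L b *: x' + y'); first exact: kernelD.
  by rewrite map_mxD map_mxZ res_teich.
have sol := submodule_solvable sph c0 c_ord dE subM.
have clos : telescope_closed c d (residue_kernel L a).
  apply: residue_kernel_closed sol => // x; apply: (lift_mulI (L := L) domV).
  by rewrite res_teich.
have [m [S SP]] := closed_finitely_generated v_surj sph c0 c_ord dE subM clos.
have /choice[S' S'P] (i : 'I_m) :
    exists x : 'rV[A]_n, x *m a = 0 /\ map_mx (res L) x = row i S.
  have /SP[x xa xS] : exists b, row i S = b *m S by exists (delta_mx 0 i); exact: rowE.
  by exists x.
have S'a : (\matrix_i S' i) *m a = 0.
  by apply/row_matrixP => i; rewrite row_mul rowK row0 (S'P i).1.
exists m, (\matrix_i S' i); apply/seteqP; split=> [x xa|_ [b _ <-]] /=.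
  have [|b ->] := kernel_generators (L := L) S'a _ xa; last by exists b.
  move=> y /SP[b ->].
  exists b; congr (b *m _); apply/row_matrixP => i.
  by rewrite -(S'P i).2 -map_row rowK.
by rewrite -mulmxA S'a mulmx0.
Qed.

Lemma val_ring_total (x y : V) : (exists b, x = b * y) \/ (exists b, y = b * x).
Proof.
have [->|x0] := eqVneq x 0; first by left; exists 0; rewrite mul0r.
have [->|y0] := eqVneq y 0; first by right; exists 0; rewrite mul0r.
by have [xy|/ltW yx] := leP (ord x) (ord y); [right|left]; exact: val_ring_dvd.
Qed.

(** The first coordinates are comparable for divisibility, and a quotient with nonzero denominator
    scales the whole vector. If the smaller one is 0, both are, and the second coordinates
    decide. *)
Lemma parallel_total (x y : 'rV[V]_2) : x 0 0 * y 0 1 = x 0 1 * y 0 0 ->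
  (exists b, x = b *: y) \/ (exists b, y = b *: x).
Proof.
wlog : x y / exists b, y 0 0 = b * x 0 0.
  move=> wl xy; have [h|h] := val_ring_total (x 0 0) (y 0 0); last exact: wl.
  by case: (wl y x h); [rewrite mulrC -xy mulrC|right|left].
move=> [b bE] xy.
have row2 (z t : 'rV[V]_2) : z 0 0 = t 0 0 -> z 0 1 = t 0 1 -> z = t.
  by move=> z0 z1; apply/rowP => -[[|[|//]] i]; [rewrite (_ : Ordinal i = 0)|
    rewrite (_ : Ordinal i = 1)] => //; exact: val_inj.
have [x0|x0] := eqVneq (x 0 0) 0.
  rewrite x0 mulr0 in bE; have [[c cE]|[c cE]] := val_ring_total (x 0 1) (y 0 1).
    by left; exists c; apply: row2; rewrite !mxE ?x0 ?bE ?mulr0.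
  by right; exists c; apply: row2; rewrite !mxE ?x0 ?bE ?mulr0.
right; exists b; apply: row2; rewrite !mxE //.
by apply: (domain_mulI domV x0); rewrite xy bE; ring.
Qed.

(** Relations between [f] and [g] are parallel, hence so are their residues. Among finitely many of
    these one generates the others, so by Nakayama one relation [y] generates all. Then
    [(g, -f) = d *: y], and for a common divisor [h] the relation [(g / h, -f / h)] is [t *: y],
    which gives [d = t * h]. *)
Lemma coherent_gcd_domain : coherent A -> gcd_domain A.
Proof.
move=> cohA; split=> // f g f0 g0.
pose a : 'cV[A]_2 := \col_i (if i == 0 then f else g).
have aE (x : 'rV[A]_2) : x *m a = 0 <-> x 0 0 * f + x 0 1 * g = 0.
  have xaE : (x *m a) 0 0 = x 0 0 * f + x 0 1 * g.
    by rewrite mxE !big_ord_recl big_ord0 addr0 !mxE /=; congr (_ * f + x 0 _ * g);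
      exact: val_inj.
  rewrite -xaE; split=> [->|xa]; first by rewrite mxE.
  by apply/matrixP => i j; rewrite !ord1 xa mxE.
pose pair (s t : A) : 'rV[A]_2 := \row_i (if i == 0 then s else t).
have pair0 s t : pair s t 0 0 = s by rewrite mxE.
have pair1 s t : pair s t 0 1 = t by rewrite mxE.
have [m [S [Sa Sgen]]] := coherent_kernel a cohA.
pose M := residue_kernel L a.
have Mpar x y : M x -> M y -> (exists b, x = b *: y) \/ (exists b, y = b *: x).
  move=> [x' /aE xa <-] [y' /aE ya <-]; apply: parallel_total.
  rewrite !mxE -!rmorphM; congr (res L _); apply: (domain_mulI domA f0).
  have xE : x' 0 0 * f = - (x' 0 1 * g) by apply/eqP; rewrite -addr_eq0 xa.
  have yE : y' 0 0 * f = - (y' 0 1 * g) by apply/eqP; rewrite -addr_eq0 ya.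
  transitivity (x' 0 0 * f * y' 0 1); first by ring.
  transitivity (x' 0 1 * (y' 0 0 * f)); last by ring.
  by rewrite xE yE; ring.
have M0 : M 0 by exists 0; [rewrite mul0mx|rewrite map_mx0].
have Mrow i : M (row i (map_mx (res L) S)).
  by exists (row i S); [rewrite -row_mul Sa row0|rewrite map_row].
have [e Me eP] : exists2 e, M e &
    forall i, exists b, row i (map_mx (res L) S) = b *: e.
  have [e Me eP] : exists2 e, M e & forall i, i \in enum 'I_m ->
      exists b, row i (map_mx (res L) S) = b *: e.
    elim: (enum 'I_m) => [|i s [e Me eP]]; first by exists 0.
    case: (Mpar _ _ (Mrow i) Me) => [[b bE]|[b bE]].
      exists e => // j; rewrite in_cons => /predU1P[->|/eP//].
      by exists b.
    exists (row i (map_mx (res L) S)) => // j; rewrite in_cons => /predU1P[->|/eP[c ->]].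
      by exists 1; rewrite scale1r.
    by exists (c * b); rewrite -scalerA -bE.
  by exists e => // i; apply: eP; rewrite mem_enum.
have [y ya yE] := Me.
have ygen x : x *m a = 0 -> exists b, x = b *: y.
  move=> xa; have [|b ->] := kernel_generators (L := L) ya _ xa.
    move=> _ [x' x'a <-].
    have [b ->] := Sgen _ x'a; have [c cE] := choice eP.
    exists (\sum_i res L (b 0 i) * c i)%:M; rewrite yE map_mxM mulmx_sum_row.
    rewrite mul_scalar_mx scaler_suml; apply: eq_bigr => i _.
    by rewrite cE scalerA mxE.
  by exists (b 0 0); rewrite [b in LHS]mx11_scalar mul_scalar_mx.
have [|d dE] := ygen (pair g (- f)).
  by apply/aE; rewrite pair0 pair1 mulNr [g * f]mulrC subrr.
have gE : g = d * y 0 0 by rewrite -(pair0 g (- f)) dE mxE.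
have fE : f = d * - y 0 1 by rewrite mulrN -[LHS]opprK -(pair1 g (- f)) dE mxE.
exists d; split; [by exists (- y 0 1); rewrite mulrC|by exists (y 0 0); rewrite mulrC|].
move=> h [f1 f1E] [g1 g1E]; have [|t tE] := ygen (pair g1 (- f1)).
  by apply/aE; rewrite pair0 pair1 f1E g1E; ring.
exists t; apply: (domain_mulI domA (x := y 0 0)).
  by apply: contraNneq g0 => y0; rewrite gE y0 mulr0.
rewrite mulrC -gE g1E; have -> : g1 = t * y 0 0 by rewrite -(pair0 g1 (- f1)) tE mxE.
ring.
Qed.

End Lift.

(** * Divisors in a GCD domain *)

Section GcdDomain.
Context (A : comNzRingType).
Hypothesis gcdA : gcd_domain A.
Let domA := gcdA.1.

(** Divide [e] and [x] by their gcd [d] to get [e'] and [x']. The gcd of [e' * y] and [x' * y] is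
    [u * y] with [u * d] dividing both [e] and [x], so [u] is a unit; as [e'] divides that gcd, it
    divides [y]. *)
Lemma gcd_domain_primal (e x y : A) : e != 0 -> x != 0 -> divides e (x * y) ->
  exists e1 e2, [/\ e = e1 * e2, divides e1 x & divides e2 y].
Proof.
move=> e0 x0 [z zE]; have [d [[e' e'E] [x' x'E] dmax]] := gcdA.2 e x e0 x0.
have d0 : d != 0 by apply: contraNneq e0 => d0; rewrite e'E d0 mulr0.
have e'0 : e' != 0 by apply: contraNneq e0 => e'0; rewrite e'E e'0 mul0r.
have x'0 : x' != 0 by apply: contraNneq x0 => x'0; rewrite x'E x'0 mul0r.
exists d, e'; split; [by rewrite mulrC | by exists x' |].
have [->|y0] := eqVneq y 0; first by exists 0; rewrite mul0r.
have x'y : x' * y = z * e'.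
  apply: (domain_mulI domA d0); transitivity (x * y); first by rewrite x'E; ring.
  by rewrite zE e'E; ring.
have [g [gex gxy gmax]] := gcdA.2 (e' * y) (x' * y) (domain_mulf_neq0 domA e'0 y0)
  (domain_mulf_neq0 domA x'0 y0).
have [u uE] : divides y g by apply: gmax; [exists e' | exists x'].
have [s sE] : divides u e'.
  case: gex => s sE; exists s; apply: (domain_mulI domA y0).
  by rewrite mulrC sE uE; ring.
have [s' s'E] : divides u x'.
  case: gxy => s' s'E; exists s'; apply: (domain_mulI domA y0).
  by rewrite mulrC s'E uE; ring.
have [t tE] : divides (u * d) d.
  by apply: dmax; [exists s; rewrite e'E sE | exists s'; rewrite x'E s'E]; ring.
have tu : 1 = t * u by apply: (domain_mulI domA d0); rewrite {1}tE; ring.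
have [r rE] : divides e' g by apply: gmax; [exists y; rewrite mulrC | exists z].
by exists (t * r); rewrite -mulrA -rE uE mulrA -tu mul1r.
Qed.

End GcdDomain.

(** * Convergent infinite products *)

Section InfiniteProduct.
Context (V A : comNzRingType) (L : strict_lift V A).
Local Notation T := (unif L).

(** [F k] is the limit of the partial products [Q k * ... * Q (n - 1) * g n]: by hypothesis, passing
    from [n] to [n + 1] changes them by a multiple of [T ^ n.+1]. *)
Lemma infinite_product (Q g : nat -> A) :
  (forall k, exists h, g k.+1 * Q k = g k + T ^+ k.+1 * h) ->
  exists F : nat -> A, forall k,
    F k = Q k * F k.+1 /\ exists E, F k = g k + T * E.
Proof.
move=> /choice[h hE].
have [P [P0 PS]] : exists P : nat -> nat -> A, (forall k, P k 0%N = 1) /\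
    forall k i, P k i.+1 = Q k * P k.+1 i.
  pose P := fix P i k := if i is j.+1 then Q k * P j k.+1 else 1.
  by exists (fun k i => P i k).
have /choice[Y YE] k := unif_series L (fun i => P k i * h (k + i)%N).
have YS k : Y k 0%N = h k + T * (Q k * Y k.+1 0%N).
  rewrite YE P0 mul1r addn0; congr (_ + T * _); apply/eqP; rewrite -subr_eq0.
  apply/eqP; apply: (unif_sep (s := L) (E := fun i => Y k i.+1 - Q k * Y k.+1 i)).
  by move=> i; rewrite (YE k i.+1) (YE k.+1 i) PS addnS addSn; ring.
exists (fun k => g k + T ^+ k.+1 * Y k 0%N) => k; split.
  rewrite [Y k 0%N]YS !mulrDr [Q k * g _]mulrC hE [T ^+ k.+2]exprS; ring.
by exists (T ^+ k * Y k 0%N); rewrite exprS mulrA.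
Qed.

End InfiniteProduct.

Fixpoint cofactorX (A : comNzRingType) (x y : A) (n : nat) : A :=
  if n is m.+1 then x * cofactorX x y m + y ^+ m else 0.

Lemma cofactorXE (A : comNzRingType) (x y : A) n :
  x ^+ n - y ^+ n = (x - y) * cofactorX x y n.
Proof.
elim: n => [|n IHn] /=; first by rewrite subrr mulr0.
rewrite mulrDr mulrCA -IHn !exprS; ring.
Qed.

Lemma cofactorX_r0 (A : comNzRingType) (x : A) n : cofactorX x 0 n.+1 = x ^+ n.
Proof.
elim: n => [|n IHn]; first by rewrite /= mulr0 add0r.
by rewrite -[LHS]/(x * cofactorX x 0 n.+1 + 0 ^+ n.+1) IHn expr0n addr0 exprS.
Qed.

Lemma rmorph_cofactorX (A B : comNzRingType) (f : {rmorphism A -> B}) x y n :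
  f (cofactorX x y n) = cofactorX (f x) (f y) n.
Proof.
elim: n => [|n IHn] /=; first exact: rmorph0.
by rewrite rmorphD rmorphM rmorphXn IHn.
Qed.

Lemma divides_trans (A : comNzRingType) (y x z : A) :
  divides x y -> divides y z -> divides x z.
Proof. by move=> [a ->] [b ->]; exists (b * a); rewrite mulrA. Qed.

Lemma dividesB (A : comNzRingType) (x y z : A) :
  divides x y -> divides x z -> divides x (y - z).
Proof. by move=> [a ->] [b ->]; exists (a - b); rewrite mulrBl. Qed.

Lemma divides_mull (A : comNzRingType) (x y z : A) :
  divides x y -> divides x (z * y).
Proof. by move=> [a ->]; exists (z * a); rewrite mulrA. Qed.

(** * Coprimality measured on residues *)

Section Lift.
Context (R : realType) (K : fieldType) (v : valuation R K).
Local Notation V := (val_ring v).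
Local Notation ord := (ord v).
Context (A : comNzRingType) (L : strict_lift V A).
Local Notation T := (unif L).
Local Notation res := (res L).
Local Notation tau := (teich L).

Let domV := @val_ring_domain _ _ v.

Lemma ord_ringM (a b : V) : a != 0 -> b != 0 -> ord (a * b : V) = ord a + ord b.
Proof. by move=> a0 b0; rewrite val_ringM ordM ?val_ring_eq0. Qed.

Lemma val_ringX_neq0 (a : V) n : a != 0 -> a ^+ n != 0.
Proof. by rewrite -!val_ring_eq0 val_ringX; exact: expf_neq0. Qed.

Lemma ord_ringX (a : V) n : a != 0 -> ord (a ^+ n : V) = ord a *+ n.
Proof. by move=> a0; rewrite val_ringX ordX ?val_ring_eq0. Qed.

Lemma ord_ringB1 (a : V) : (a != 0 -> 0 < ord a) ->
  1 - a != 0 /\ ord (1 - a : V) = 0.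
Proof.
move=> a0; rewrite -val_ring_eq0 val_ringB val_ring1.
rewrite -(ord_one v); apply: ordDl; rewrite ?oner_eq0 //.
by rewrite oppr_eq0 ordN ord_one val_ring_eq0.
Qed.

Lemma ord_sign n : (-1) ^+ n != 0 :> V /\ ord ((-1) ^+ n : V) = 0.
Proof.
have N1 : (-1 : V) != 0 by rewrite oppr_eq0 oner_eq0.
split; first exact: val_ringX_neq0.
have -> : ord ((-1) ^+ n : V) = ord (-1 : V) *+ n by exact: ord_ringX.
by rewrite -[X in ord X]/(- 1) ordN ord_one mul0rn.
Qed.

Lemma res_divides_neq0 x y : divides x y -> res y != 0 -> res x != 0.
Proof.
by move=> [z ->]; apply: contraNneq => x0; rewrite rmorphM x0 mulr0.
Qed.

Lemma res_divides_ord x y : divides x y -> res y != 0 -> ord (res x) <= ord (res y).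
Proof.
move=> [z ->]; rewrite rmorphM => zx.
have z0 : res z != 0 by apply: contraNneq zx => ->; rewrite mul0r.
have x0 : res x != 0 by apply: contraNneq zx => ->; rewrite mulr0.
by rewrite ord_ringM // lerDr ord_ge0.
Qed.

(* The divisors of unif ^+ N are unif ^+ i up to units. *)
Lemma unifX_divisor_ord N w e :
  divides e (T ^+ N * w) -> res w != 0 -> ord (res w) = 0 -> res e != 0 ->
  ord (res e) = 0.
Proof.
move=> + w0 wo e0; elim: N => [|N IHN] [z zE].
  apply/eqP; rewrite eq_le ord_ge0 andbT -wo; apply: res_divides_ord => //.
  by exists z; rewrite -zE mul1r.
have /res_eq0[z' z'E] : res z = 0.
  move/(congr1 res): zE; rewrite exprS -mulrA !rmorphM res_unif mul0r.
  by rewrite mulrC => /esym/domV; rewrite (negPf e0) => /eqP.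
apply: IHN; exists z'; apply: (unif_mulI (L := L)).
by rewrite mulrA -exprS zE z'E mulrA.
Qed.

(** Common divisors of residue 0 pass because of the junk value of [ord]; the coprimality lemmas
    concern elements of nonzero residue, whose divisors have nonzero residue too. *)
Definition ord_coprime x y :=
  forall e, divides e x -> divides e y -> ord (res e) = 0.

Lemma ord_coprime_sym x y : ord_coprime x y -> ord_coprime y x.
Proof. by move=> xy e ey ex; exact: xy. Qed.

(** In a GCD domain a divisor of a product splits along its factors, and the valuation of the
    residue is additive over the pieces. *)
Lemma ord_coprime_prod (gcdA : gcd_domain A) k (F : nat -> A) y :
  (forall j, res (F j) != 0) -> (forall j, (j < k)%N -> ord_coprime (F j) y) ->
  ord_coprime (\prod_(j < k) F j) y.
Proof.
move=> F0; elim: k => [|k IHk] Fy e.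
  rewrite big_ord0 => e1 _; apply: (@unifX_divisor_ord 0 1) => //.
  - by rewrite mul1r.
  - by rewrite rmorph1 oner_eq0.
  - by rewrite rmorph1 val_ring1 ord_one.
  - by apply: res_divides_neq0 e1 _; rewrite rmorph1 oner_eq0.
have P0 m : res (\prod_(j < m) F j) != 0.
  elim: m => [|m IHm]; first by rewrite big_ord0 rmorph1 oner_eq0.
  by rewrite big_ord_recr rmorphM val_ring_mulf_neq0.
move=> eP ey; have e0 := res_divides_neq0 eP (P0 _).
have neq0 x : res x != 0 -> x != 0.
  by apply: contraNneq => ->; rewrite rmorph0.
have [|||e1 [e2 [eE e1P e2F]]] := gcd_domain_primal gcdA (e := e)
  (x := \prod_(j < k) F j) (y := F k); [exact: neq0|exact: neq0| |].
  by move: eP; rewrite big_ord_recr.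
move: e0; rewrite eE rmorphM => e0.
rewrite ord_ringM; [|by apply: contraNneq e0 => ->; rewrite mul0r|
                     by apply: contraNneq e0 => ->; rewrite mulr0].
rewrite (IHk _ e1) ?add0r //; last first.
- by apply: divides_trans ey; exists e2; rewrite eE mulrC.
- by move=> j jk; apply: Fy; exact: ltnW.
apply: (Fy k) => //; apply: divides_trans ey; by exists e1.
Qed.

Lemma oppr_unifX n : (- T) ^+ n = T ^+ n * (-1) ^+ n.
Proof. rewrite [LHS]exprNn; exact: mulrC. Qed.

Lemma res_diffX (s : V) n : res (tau s ^+ n.+1 - (- T) ^+ n.+1) = s ^+ n.+1.
Proof.
rewrite rmorphB !rmorphXn rmorphN res_teich res_unif oppr0.
by rewrite expr0n subr0.
Qed.

(** With the common exponent [N], a common divisor divides [tau s ^ N - (-T) ^ N] and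
    [tau (q * s) ^ N - (-T) ^ N]. Their difference is [tau s ^ N * w] with [w = 1 - tau q ^ N], so
    it also divides [(-T) ^ N * w], where [w] has residue of valuation 0. *)
Lemma diffX_coprime (s q : V) n m : s != 0 -> (q != 0 -> 0 < ord q) ->
  ord_coprime (tau s ^+ n.+1 - (- T) ^+ n.+1)
              (tau (q * s) ^+ m.+1 - (- T) ^+ m.+1).
Proof.
move=> s0 q0 e es eqs; pose N := (n.+1 * m.+1)%N.
have dX (x y : A) i j : divides (x ^+ i - y ^+ i) (x ^+ (i * j) - y ^+ (i * j)).
  by rewrite !exprM; exists (cofactorX (x ^+ i) (y ^+ i) j); rewrite cofactorXE mulrC.
have {}es' : divides e (tau s ^+ N - (- T) ^+ N) by exact: divides_trans es (dX _ _ _ _).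
have {}eqs : divides e (tau (q * s) ^+ N - (- T) ^+ N).
  by rewrite /N mulnC; exact: divides_trans eqs (dX _ _ _ _).
pose w := 1 - tau q ^+ N.
have eT : divides e (T ^+ N * ((-1) ^+ N * w)).
  rewrite mulrA -oppr_unifX.
  have -> : (- T) ^+ N * w = tau s ^+ N * w - w * (tau s ^+ N - (- T) ^+ N) by ring.
  apply: dividesB; last exact: divides_mull.
  have -> : tau s ^+ N * w =
      (tau s ^+ N - (- T) ^+ N) - (tau (q * s) ^+ N - (- T) ^+ N).
    by rewrite teichM exprMn /w; ring.
  exact: dividesB.
have resw : res ((-1) ^+ N * w) = (-1) ^+ N * (1 - q ^+ N).
  by rewrite rmorphM rmorphXn rmorphN rmorphB rmorphXn rmorph1 res_teich.
have [sN0 sNo] := ord_sign N.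
have [|wN0 wNo] := @ord_ringB1 (q ^+ N).
  have [->|qn0 _] := eqVneq q 0; first by rewrite expr0n eqxx.
  by rewrite ord_ringX // mulrn_wgt0 // q0.
apply: unifX_divisor_ord eT _ _ _; rewrite ?resw.
- exact: val_ring_mulf_neq0.
- by rewrite ord_ringM // sNo wNo addr0.
- by apply: res_divides_neq0 es _; rewrite res_diffX val_ringX_neq0.
Qed.

Lemma res_cofactorX s n : res (cofactorX (tau s) (- T) n.+1) = s ^+ n.
Proof.
by rewrite rmorph_cofactorX rmorphN res_unif oppr0 res_teich cofactorX_r0.
Qed.

(** The recursion for [cofactorX] is one Euclidean step with remainder [(-T) ^ n.+1]. *)
Lemma cofactorX_coprime (s : V) n : s != 0 ->
  ord_coprime (cofactorX (tau s) (- T) n.+1) (cofactorX (tau s) (- T) n.+2).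
Proof.
move=> s0 e en eS; have e0 : res e != 0.
  by apply: res_divides_neq0 en _; rewrite res_cofactorX val_ringX_neq0.
have [sN0 sNo] := ord_sign n.+1.
apply: (@unifX_divisor_ord n.+1 ((-1) ^+ n.+1)) => //.
- rewrite -oppr_unifX.
  have -> : (- T) ^+ n.+1 = cofactorX (tau s) (- T) n.+2 -
      tau s * cofactorX (tau s) (- T) n.+1.
    rewrite -[cofactorX _ _ n.+2]/(tau s * cofactorX (tau s) (- T) n.+1 + _).
    by rewrite [X in X - _]addrC addrK.
  by apply: dividesB => //; exact: divides_mull.
- by rewrite rmorphXn rmorphN1.
- by rewrite rmorphXn rmorphN1.
Qed.

End Lift.

(** * From common divisors to pseudo-limits *)

Lemma div_exp2_lt (R : realType) (e : R) : 0 < e ->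
  exists k, (2 * k + 5)%:R / 2 ^+ k < e.
Proof.
move=> e0; have [|k kE] := @inv_nat_lt R (e / 16); first by rewrite divr_gt0.
(* The constant 16 is generous; any value from 7 on would bound the ratio. *)
have bound : ((2 * k + 5) * k.+1 <= 16 * 2 ^ k)%N.
  by elim: k {kE} => // -[|k] IHk //; rewrite expnS; nia.
exists k; rewrite -natrX ltr_pdivrMr ?ltr0n ?expn_gt0 //.
have k0 : 0 < k.+1%:R :> R by rewrite ltr0n.
rewrite -(ltr_pM2r k0) -natrM; apply: le_lt_trans (_ : (16 * 2 ^ k)%:R < _).
  by rewrite ler_nat.
move: kE; rewrite -(ltr_pM2r k0) mulVf ?gt_eqF // => kE.
have : 0 < (2 ^ k)%:R :> R by rewrite ltr0n expn_gt0.
rewrite natrM => p0; nra.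
Qed.

Section Lift.
Context (R : realType) (K : fieldType) (v : valuation R K).
Hypothesis v_surj : val_group_full v.
Local Notation V := (val_ring v).
Local Notation ord := (ord v).
Context (A : comNzRingType) (L : strict_lift V A).
Local Notation T := (unif L).
Local Notation res := (res L).
Local Notation tau := (teich L).
Hypothesis gcdA : gcd_domain A.

Let domV := @val_ring_domain _ _ v.
Let domA := gcdA.1.

Section Divisor.
Context (t : nat -> V).
Hypothesis t_neq0 : forall k, t k != 0.
Hypothesis t_ord : forall k, ord (t k) = (2 ^+ k.+1)^-1.

(** This is the linear factor [[t k] + T], written as a difference to match [cofactorXE] with
    [y = - T]. *)
Let ell k : A := tau (t k) - - T.
Let Q c k : A := tau (t k) ^+ (k + c).+1 - (- T) ^+ (k + c).+1.
Let cof c k : A := cofactorX (tau (t k)) (- T) (k + c).+1.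

Let QE c k : Q c k = ell k * cof c k.
Proof. exact: cofactorXE. Qed.

(* (k + c + 2) / 2 ^ k is the sum of (j + c + 1) / 2 ^ (j + 1) over j >= k. *)
Lemma multiple_of_divisor c : exists (g : nat -> V) (F : nat -> A), forall k,
  [/\ g k != 0, ord (g k) = (k + c + 2)%:R / 2 ^+ k, res (F k) = g k &
      F k = Q c k * F k.+1].
Proof.
have [x0 x00 x0E] := ord_surj v_surj (c + 2)%:R.
pose g := fix g k := if k is j.+1 then g j / (t j : K) ^+ (j + c).+1 else x0.
have tK k : (t k : K) != 0 by rewrite val_ring_eq0.
have gP k : g k != 0 /\ ord (g k) = (k + c + 2)%:R / 2 ^+ k.
  elim: k => [|k [gk0 gkE]] /=; first by rewrite divr1 add0n.
  have tk0 : ((t k : K) ^+ (k + c).+1)^-1 != 0 by rewrite invr_eq0 expf_neq0.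
  split; first by rewrite mulf_neq0.
  rewrite ordM // gkE ordV ?expf_neq0 // ordX // t_ord -[_ *+ (k + c).+1]mulr_natr.
  rewrite exprS -[(k + c).+1]addn1 -[k.+1]addn1 !natrD; field.
  by rewrite expf_neq0 // pnatr_eq0.
have /choice[g' g'E] k : exists a : V, (a : K) = g k.
  apply: val_ring_lift; rewrite leord ?(gP k).1 // (gP k).2.
  by rewrite divr_ge0 // exprn_ge0.
have g'P k : g' k != 0 /\ ord (g' k) = (k + c + 2)%:R / 2 ^+ k.
  by rewrite -val_ring_eq0 g'E; exact: gP.
have g'S k : g' k = g' k.+1 * t k ^+ (k + c).+1.
  by apply: val_ring_inj; rewrite val_ringM val_ringX !g'E /= divfK // expf_neq0.
have [|F FP] := @infinite_product _ _ L (Q c) (fun k => tau (g' k)).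
  (* Since [tau] is multiplicative, [g' k.+1 * Q c k] misses [g' k] only by the term in
     [(-T) ^ (k + c).+1]. The exponent grows with [k] precisely so that [T ^ k.+1] divides it. *)
  move=> k; exists (- (tau (g' k.+1) * ((-1) ^+ (k + c).+1 * T ^+ c))).
  rewrite [g' k]g'S teichM teichX /Q [(- T) ^+ _]exprNn.
  have -> : T ^+ (k + c).+1 = T ^+ k.+1 * T ^+ c by rewrite -exprD addSn.
  ring.
exists g', F => k; have [FE [E EE]] := FP k.
split=> //; [exact: (g'P k).1|exact: (g'P k).2|].
by rewrite EE rmorphD rmorphM res_unif mul0r addr0 res_teich.
Qed.

(** For [i = j] the exponents are consecutive. Otherwise the cofactors divide [Q 0 i] and [Q 1 j],
    and the [t] with smaller index is a multiple of the other by an element of positive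
    valuation. *)
Let cof_coprime i j : ord_coprime L (cof 0 i) (cof 1 j).
Proof.
have [<-|] := eqVneq i j.
  by rewrite /cof addn0 addn1; exact: cofactorX_coprime.
have qE m n : (m < n)%N -> exists q, t m = q * t n /\ (q != 0 -> 0 < ord q).
  move=> mn; have [//||q tE] := @val_ring_dvd _ _ v (t n) (t m).
    move=> _; rewrite !t_ord lef_pV2 ?posrE ?exprn_gt0 // ler_eXn2l ?ltr1n //.
    exact: leqW.
  exists q; split=> // q0; have := congr1 (fun x : V => ord x) tE.
  rewrite /= ord_ringM // !t_ord => qE; rewrite -(ltrD2r (2 ^+ n.+1)^-1) -qE add0r.
  by rewrite ltf_pV2 ?posrE ?exprn_gt0 // ltr_eXn2l ?ltr1n.
have dQ c k : divides (cof c k) (Q c k) by exists (ell k); exact: QE.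
rewrite neq_ltn => /orP[ij|ji] e ei ej.
  have [q [tE q0]] := qE _ _ ij.
  apply: (diffX_coprime (s := t j) (q := q)) (divides_trans ej (dQ _ _)) _ => //.
  by rewrite -tE; exact: divides_trans ei (dQ _ _).
have [q [tE q0]] := qE _ _ ji.
apply: (diffX_coprime (s := t i) (q := q)) (divides_trans ei (dQ _ _)) _ => //.
by rewrite -tE; exact: divides_trans ej (dQ _ _).
Qed.

(** Dividing the gcd [h] by the first [k] linear factors leaves [H k]. The quotient [q k] of its
    first two digits is additive in products, so it differs from [q 0] by the partial sum of the
    [1 / t j]. As the second digit is integral, it remains to bound the valuation of [res (H k)]. *)
Lemma gcd_partial_sums : exists a : K, forall k,
  ((- ((2 * k + 5)%:R / 2 ^+ k))%:E <= v (a - \sum_(j < k) (t j : K)^-1)%R)%E.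
Proof.
have [g [F FP]] := multiple_of_divisor 0; have [g' [F' FP']] := multiple_of_divisor 1.
pose P k := \prod_(j < k) ell j.
have prodQ c (G : nat -> A) k : (forall i, G i = Q c i * G i.+1) ->
    G 0%N = P k * (\prod_(j < k) cof c j * G k).
  move=> GE; rewrite mulrA /P -big_split /=; elim: k => [|k IHk].
    by rewrite big_ord0 mul1r.
  by rewrite big_ord_recr /= -QE -mulrA -GE.
have res_neq0 (x : A) : res x != 0 -> x != 0.
  by apply: contraNneq => ->; rewrite rmorph0.
have res_ell k : res (ell k) = t k.
  by rewrite rmorphB rmorphN res_teich res_unif opprK addr0.
have cof0 c k : res (cof c k) != 0 by rewrite res_cofactorX val_ringX_neq0.
have prod0 (G : nat -> A) k : (forall i, res (G i) != 0) ->
    res (\prod_(j < k) G j) != 0.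
  move=> G0; elim: k => [|k IHk]; first by rewrite big_ord0 rmorph1 oner_eq0.
  by rewrite big_ord_recr rmorphM val_ring_mulf_neq0.
have P0 k : res (P k) != 0 by apply: prod0 => i; rewrite res_ell.
have F0 k : res (F k) != 0 by have [? _ -> _] := FP k.
have F'0 k : res (F' k) != 0 by have [? _ -> _] := FP' k.
have [h [hF hF' hmax]] := gcdA.2 _ _ (res_neq0 _ (F0 0%N)) (res_neq0 _ (F'0 0%N)).
have /choice[H HE] k : exists x, h = x * P k.
  apply: hmax; [exists (\prod_(j < k) cof 0 j * F k)|
    exists (\prod_(j < k) cof 1 j * F' k)];
    by rewrite mulrC; apply: prodQ => i; case: (FP i) (FP' i) => _ _ _ ? [].
have HS k : H k = ell k * H k.+1.
  apply: (domain_mulI domA (res_neq0 _ (P0 k))).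
  by rewrite mulrC -HE (HE k.+1) /P big_ord_recr /=; ring.
have Hdvd c (G : nat -> A) k : (forall i, G i = Q c i * G i.+1) ->
    divides h (G 0%N) ->
    divides (H k) (\prod_(j < k) cof c j * G k).
  move=> GE [z zE]; exists z; apply: (domain_mulI domA (res_neq0 _ (P0 k))).
  by rewrite -prodQ // zE {1}(HE k); ring.
have H0 k : res (H k) != 0.
  have h0 : res h != 0 by exact: res_divides_neq0 hF (F0 _).
  by apply: contraNneq h0 => Hk; rewrite (HE k) rmorphM Hk mul0r.
(* [H k] divides each cofactor product times [F k], respectively [F' k]. It therefore splits as
   [a1 * a2 * b] with [b] dividing [F k], [a2] dividing [F' k], and [a1] dividing both cofactor
   products, which are coprime. The bound adds [(k + 2) / 2 ^ k] and [(k + 3) / 2 ^ k]. *)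
have H_ord k : ord (res (H k)) <= (2 * k + 5)%:R / 2 ^+ k.
  have FE i : F i = Q 0 i * F i.+1 by have [] := FP i.
  have FE' i : F' i = Q 1 i * F' i.+1 by have [] := FP' i.
  have [||a [b [abE aR bF]]] := gcd_domain_primal gcdA _ _ (Hdvd _ _ k FE hF).
  - exact: res_neq0.
  - by apply: res_neq0; exact: prod0.
  have : divides a (\prod_(j < k) cof 1 j * F' k).
    by apply: divides_trans (Hdvd _ _ k FE' hF'); exists b; rewrite abE mulrC.
  have ab0 : res a != 0 /\ res b != 0.
    by split; [apply: res_divides_neq0 aR _|
      apply: res_divides_neq0 bF _] => //; exact: prod0.
  case/(gcd_domain_primal gcdA (res_neq0 _ ab0.1) _).
    by apply: res_neq0; exact: prod0.
  move=> a1 [a2 [aE a1R a2F]].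
  have a1_ord : ord (res a1) = 0.
    have : ord_coprime L (\prod_(j < k) cof 0 j) (\prod_(j < k) cof 1 j).
      apply: ord_coprime_prod => // j _; apply: ord_coprime_sym.
      by apply: ord_coprime_prod => // i _; apply/ord_coprime_sym/cof_coprime.
    by apply=> //; apply: divides_trans aR; exists a2; rewrite aE mulrC.
  have a120 : res a1 != 0 /\ res a2 != 0.
    by split; [apply: res_divides_neq0 a1R _|
      apply: res_divides_neq0 a2F _] => //; exact: prod0.
  rewrite abE aE !rmorphM !ord_ringM ?val_ring_mulf_neq0 ?ab0.2 ?a120.1 ?a120.2 //.
  rewrite a1_ord add0r.
  have := res_divides_ord a2F (F'0 k); have := res_divides_ord bF (F0 k).
  have [_ gE -> _] := FP k; have [_ gE' -> _] := FP' k; rewrite gE gE'.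
  have -> : (2 * k + 5)%:R / 2 ^+ k =
      (k + 0 + 2)%:R / 2 ^+ k + (k + 1 + 2)%:R / 2 ^+ k :> R.
    by rewrite -mulrDl -natrD; congr (_%:R / _); lia.
  lra.
have /choice[y yE] k : exists y, H k = tau (res (H k)) + T * y.
  by apply: res_eq; rewrite res_teich.
have resHS k : res (H k) = t k * res (H k.+1) by rewrite {1}HS rmorphM res_ell.
have res_yS k : res (y k) = t k * res (y k.+1) + res (H k.+1).
  (* The factor [ell k] has digits [t k] and 1, so comparing second digits in [H k = ell k * H k.+1]
     is the product rule. *)
  have : tau (res (H k)) + T * y k =
      (tau (t k) + T * 1) * (tau (res (H k.+1)) + T * y k.+1).
    by rewrite -!yE mulr1 -[T in RHS]opprK; exact: HS.
  rewrite res_factorM -resHS => /addrI /(unif_mulI (L := L)) ->.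
  by rewrite !rmorphD !rmorphM res_unif mul0r addr0 !res_teich rmorph1 mulr1.
pose q k : K := (res (y k) : K) / (res (H k) : K).
have HK k : (res (H k) : K) != 0 by rewrite val_ring_eq0.
have tK k : (t k : K) != 0 by rewrite val_ring_eq0.
have qS k : q k = q k.+1 + (t k : K)^-1.
  rewrite /q resHS res_yS val_ringD !val_ringM; field.
  by rewrite HK tK.
have qE k : q 0%N - \sum_(j < k) (t j : K)^-1 = q k.
  elim: k => [|k IHk]; first by rewrite big_ord0 subr0.
  by rewrite big_ord_recr opprD addrA /= IHk qS addrK.
exists (q 0%N) => k; rewrite qE; apply: (@le_valW _ _ _ _ (0 - ord (res (H k)))).
  by rewrite sub0r lerN2.
apply: le_valM; first exact: val_ring_ge0.
by rewrite leord ?invr_eq0 // ordV.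
Qed.

End Divisor.

(** To be inverses of the [t k], the increments must have valuation exactly [- e k]. Moving [s k] by
    some [d k] of valuation at least [- e k] achieves this for the [k]th increment, and the later
    move of [s k.+1] is too small to disturb it. *)
Lemma gcd_pseudo_limit (s : nat -> K) :
  (forall k, ((- (2 ^+ k.+1)^-1)%:E <= v (s k.+1 - s k)%R)%E) ->
  exists a, forall k, ((- ((2 * k + 5)%:R / 2 ^+ k))%:E <= v (a - s k)%R)%E.
Proof.
move=> sS; pose e k : R := (2 ^+ k.+1)^-1.
have e_gt0 k : 0 < e k by rewrite invr_gt0 exprn_gt0.
have eS k : e k.+1 < e k.
  by rewrite ltf_pV2 ?posrE ?exprn_gt0 // ltr_eXn2l ?ltr1n.
have /choice[d dP] k : exists d, [/\ ((- e k)%:E <= v d)%E,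
    s k.+1 - (s k + d) != 0 & ord (s k.+1 - (s k + d)) = - e k].
  have DE d : s k.+1 - (s k + d) = s k.+1 - s k - d by rewrite opprD addrA.
  set D := s k.+1 - s k in DE.
  have [Dk|Dk] := pselect (D != 0 /\ ord D = - e k).
    by exists 0; rewrite DE subr0 val0 leey; case: Dk.
  have [x x0 xE] := ord_surj v_surj (- e k).
  exists (- x); rewrite DE val_opp leord // xE opprK addrC lexx.
  have [||-> ->] := @ordDl _ _ v x D => //; move=> D0.
  rewrite xE lt_neqAle eq_sym -leord // sS andbT.
  by apply/eqP => DkE; apply: Dk.
pose s' k := s k + d k.
have s'P k : s' k.+1 - s' k != 0 /\ ord (s' k.+1 - s' k) = - e k.
  have [_ u0 uE] := dP k; have [dS _ _] := dP k.+1.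
  rewrite /s' addrAC -uE; apply: ordDl => // d0.
  by rewrite uE; move: dS; rewrite leord //; apply: lt_le_trans; rewrite ltrN2.
have /choice[t tE] k : exists a : V, (a : K) = (s' k.+1 - s' k)^-1.
  apply: val_ring_lift; have [u0 uE] := s'P k.
  by rewrite leord ?invr_eq0 // ordV // uE opprK ltW.
have [||a aP] := @gcd_partial_sums t.
- by move=> k; rewrite -val_ring_eq0 tE invr_eq0; have [] := s'P k.
- by move=> k; rewrite tE; have [u0 uE] := s'P k; rewrite ordV // uE opprK.
have sumE k : \sum_(j < k) (t j : K)^-1 = s' k - s' 0%N.
  under eq_bigr do rewrite tE invrK.
  by elim: k => [|k IHk]; rewrite ?big_ord0 ?subrr // big_ord_recr IHk /= addrC subrKA.
exists (a + s' 0%N) => k; apply: (le_val_trans (y := s' k)).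
  by have := aP k; rewrite sumE opprB addrA.
rewrite /s' addrC addKr; have [dk _ _] := dP k; apply: le_valW dk.
rewrite lerN2 /e exprS invfM ler_pM2r ?invr_gt0 ?exprn_gt0 //.
by rewrite natrD natrM; have : 0 <= k%:R :> R by []; lra.
Qed.

(** If the radii are unbounded, the centres form a Cauchy sequence and completeness applies; if
    their supremum is attained, the centre of that ball works. Otherwise balls with radii close to
    the supremum yield a sequence with a pseudo-limit. *)
Lemma gcd_domain_spherical : val_complete v -> spherically_complete v.
Proof.
move=> v_complete F Fball Fchain.
have dist a r b s : F (val_closed_ball v a r) -> F (val_closed_ball v b s) ->
    r <= s -> (r%:E <= v (a - b)%R)%E.
  have center c u : val_closed_ball v c u c.
    by rewrite /val_closed_ball /= subrr val0 leey.
  move=> Fa Fb rs; have [ab|ba] := Fchain _ _ Fa Fb.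
    by apply: le_valW rs _; exact: (ab _ (center a r)).
  by rewrite val_distC; exact: (ba _ (center b s)).
have dist_min a r b s u : F (val_closed_ball v a r) -> F (val_closed_ball v b s) ->
    u <= r -> u <= s -> (u%:E <= v (a - b)%R)%E.
  move=> Fa Fb ur us; have [rs|/ltW sr] := leP r s.
    by apply: le_valW ur _; exact: dist Fa Fb rs.
  by apply: le_valW us _; rewrite val_distC; exact: dist Fb Fa sr.
have inter x : (forall a r, F (val_closed_ball v a r) -> (r%:E <= v (x - a)%R)%E) ->
    (\bigcap_(B in F) B) !=set0.
  by move=> xF; exists x => B FB; have [a [r BE]] := Fball _ FB; rewrite BE; apply: xF;
    rewrite -BE.
pose rad := [set r | exists a, F (val_closed_ball v a r)].
have [rad0|] := pselect (rad !=set0); last first.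
  by move=> rad0; apply: (inter 0) => a r Fa; case: rad0; exists r, a.
have [radb|] := pselect (has_sup rad); last first.
  move=> /(has_supPn rad0) unb.
  have /choice[a aP] (n : nat) :
      exists a, exists2 r, F (val_closed_ball v a r) & n%:R <= r.
    by have [r [a Fa] /ltW nr] := unb n%:R; exists a, r.
  have nat_ge (r : R) : exists N : nat, forall n, (N <= n)%N -> r <= n%:R.
    exists (Num.bound `|r|) => n nN; apply: le_trans (ler_norm r) _.
    by apply/ltW; apply: lt_le_trans (archi_boundP (normr_ge0 r)) _; rewrite ler_nat.
  have [|l lP] := v_complete a.
    move=> r; have [N NP] := nat_ge r; exists N => m n mN nN.
    have [rm Fm mr] := aP m; have [rn Fn nr] := aP n.
    by apply: dist_min Fm Fn _ _; [apply: le_trans mr|apply: le_trans nr]; exact: NP.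
  apply: (inter l) => b r Fb; have [N NP] := nat_ge r; have [M MP] := lP r.
  have [s Fs sM] := aP (maxn N M); apply: (le_val_trans (y := a (maxn N M))).
    by rewrite val_distC; apply: MP; exact: leq_maxr.
  apply: dist_min Fs Fb _ _ => //; apply: le_trans sM; apply: NP; exact: leq_maxl.
have rad_le r : rad r -> r <= sup rad by apply: ub_le_sup; exact: radb.2.
have [[a Fa]|nsup] := pselect (rad (sup rad)).
  apply: (inter a) => b s Fb; apply: (dist_min _ _ _ _ _ Fa Fb) => //.
  by apply: rad_le; exists b.
have rad_lt r : rad r -> r < sup rad.
  by move=> rr; rewrite lt_neqAle rad_le // andbT; apply: contra_notN nsup => /eqP <-.
have /choice[a aP] (k : nat) : exists a, exists2 r, F (val_closed_ball v a r) &
    sup rad - (2 ^+ k.+1)^-1 < r.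
  have [|r [a Fa] ar] := @sup_adherent _ rad (2 ^+ k.+1)^-1 _ radb.
    by rewrite invr_gt0 exprn_gt0.
  by exists a, r.
(* Scaling by [c] moves the supremum of the radii to 0, so that the increments of [c * a k] have
   valuation at least [- 1 / 2 ^ k.+1]. *)
have [c c0 cE] := ord_surj v_surj (- sup rad).
have [|x xP] := @gcd_pseudo_limit (fun k => c * a k).
  move=> k; rewrite -mulrBr.
  have -> : - (2 ^+ k.+1)^-1 = - sup rad + (sup rad - (2 ^+ k.+1)^-1) :> R by ring.
  apply: le_valM; first by rewrite leord // cE.
  have [r Fr kr] := aP k; have [s Fs ks] := aP k.+1.
  apply: dist_min Fs Fr _ _; apply/ltW => //; apply: le_lt_trans ks.
  by rewrite lerD2l lerN2 lef_pV2 ?posrE ?exprn_gt0 // ler_eXn2l ?ltr1n.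
apply: (inter (c^-1 * x)) => b s Fb.
have [k kP] : exists k, (2 * k + 5)%:R / 2 ^+ k < sup rad - s.
  by apply: div_exp2_lt; rewrite subr_gt0; apply: rad_lt; exists b.
apply: (le_val_trans (y := a k)).
  have -> : c^-1 * x - a k = c^-1 * (x - c * a k) by rewrite mulrBr mulKf.
  apply: (@le_valW _ _ _ _ (sup rad - (2 * k + 5)%:R / 2 ^+ k)).
    by rewrite lerBrDr -lerBrDl ltW.
  by apply: le_valM (xP k); rewrite leord ?invr_eq0 // ordV // cE opprK.
have [r Fr kr] := aP k; apply: dist_min Fr Fb _ _ => //.
have : (2 ^+ k.+1)^-1 <= (2 * k + 5)%:R / 2 ^+ k :> R.
  rewrite exprS invfM ler_pM2r ?invr_gt0 ?exprn_gt0 //.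
  by rewrite natrD natrM; have : 0 <= k%:R :> R by []; lra.
lra.
Qed.

End Lift.

(** * Perfect valuation rings of characteristic p, and the equivalences *)

Lemma pchar_val_ring (R : realType) (K : fieldType) (v : valuation R K) p :
  p \in [pchar K] -> p \in [pchar (val_ring v)].
Proof.
move=> /andP[p_pr /eqP pK]; apply/andP; split=> //; apply/eqP.
apply: val_ring_inj; rewrite val_ring0 -pK.
exact: (rmorph_nat (val : val_ring v -> K)).
Qed.

Lemma frobenius_val_ring_bij (R : realType) (K : fieldType) (v : valuation R K)
    p (charKp : p \in [pchar K]) :
  bijective (pFrobenius_aut charKp) ->
  bijective (fun a : val_ring v => a ^+ p).
Proof.
case=> g gK Kg; have p_gt0 := prime_gt0 (pcharf_prime charKp).
have gX x : g x ^+ p = x by rewrite -[RHS]Kg pFrobenius_autE.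
have Xg x : g (x ^+ p) = x by rewrite -[RHS]gK pFrobenius_autE.
have /choice[f fE] (a : val_ring v) : exists b : val_ring v, (b : K) = g (a : K).
  apply: val_ring_lift; have [->|g0] := eqVneq (g (a : K)) 0; first by rewrite val0 leey.
  rewrite leord // -(pmulrn_lge0 _ p_gt0) -ordX // gX; exact: ord_ge0.
by exists f => a; apply: val_ring_inj; [rewrite fE val_ringX Xg|rewrite val_ringX fE gX].
Qed.

Theorem theorem1p1 (R : realType) (K : fieldType) (v : valuation R K)
    (v_complete : val_complete v) (v_surj : val_group_full v) :
  [<-> spherically_complete v;
       coherent (fps (val_ring v));
       gcd_domain (fps (val_ring v))] /\
  (forall (p : nat) (p_pr : prime p) (charKp : p \in [pchar K]),
     bijective (pFrobenius_aut charKp) ->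
     [<-> spherically_complete v;
          coherent (witt p_pr (val_ring v));
          gcd_domain (witt p_pr (val_ring v))]).
Proof.
have main (A : comNzRingType) : strict_lift (val_ring v) A ->
    [<-> spherically_complete v; coherent A; gcd_domain A].
  move=> L; tfae.
  - exact: spherical_coherent v_surj _ L.
  - exact: coherent_gcd_domain L.
  - by move=> gcdA; exact: gcd_domain_spherical v_surj _ L gcdA v_complete.
split=> [|p p_pr charKp frob_bij]; apply: main; first exact: fps_strict_lift.
apply: witt_strict_lift; first exact: (pchar_val_ring v charKp).
exact: frobenius_val_ring_bij frob_bij.
Qed.
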